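(* Let $\Psi$ be the zero set of the symmetric simple random walk on $\mathbb Z$ with uniform jumps in $\{\pm1\}$. Then $$\mathrm{udim}_M(\Psi)=\mathrm{udim}_H(\Psi)=\tfrac12.$$
   Context: The random walk $(S_n)_{n\in\mathbb Z}$ is double-sided, with $S_0=0$ and i.i.d. jumps $S_n-S_{n-1}$ uniform in $\{\pm1\}$; $\Psi=\{n\in\mathbb Z:S_n=0\}\subseteq\mathbb R$ with the Euclidean metric and origin $0$. It is a point-stationary point process, i.e. a random locally finite subset of $\mathbb R$ with $0\in\Psi$ a.s. such that $\mathbb E[\sum_{x\in\Psi}g(\Psi,0,x)]=\mathbb E[\sum_{x\in\Psi}g(\Psi,x,0)]$ for all measurable $g(\varphi,x,y)\ge0$ invariant under joint translations. Equivariant processes. An equivariant process with values in a complete separable metric space $\Xi$ on $\Psi$ assigns to (almost) every realization $\varphi$ a random marking $\boldsymbol Z_\varphi\in\Xi^{\varphi\times\varphi}$ (extra randomness allowed; the mark of a point $x$ is that of $(x,x)$), depending measurably on $\varphi$, such that for every translation $\rho$, $\boldsymbol Z_\varphi\circ\rho^{-1}$ has the same distribution as $\boldsymbol Z_{\rho(\varphi)}$. An equivariant subset is the set of points with mark 1 in a $\{0,1\}$-valued equivariant process; its intensity is $\mathbb P[0\in\boldsymbol S_\Psi]$. Dimensions. $N_r(v)$ is the closed ball in $\Psi$ of radius $r\ge1$ and $N_0(v):=\emptyset$. An equivariant $r$-covering is an equivariant subset $\boldsymbol R$ such that the balls $N_r(v)$, $v\in\boldsymbol R_\Psi$, cover $\Psi$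 a.s.; $\lambda_r$ is the infimum of their intensities; $\mathrm{udim}_M(\Psi):=\lim_{r\to\infty}\frac{-\log\lambda_r}{\log r}$ when the limit exists (the statement includes existence). An equivariant covering is an equivariant process $\boldsymbol R$ with values in $\{0\}\cup[1,\infty)$ on points such that the balls $N_{\boldsymbol R(v)}(v)$ cover $\Psi$ a.s.; $\mathcal H^\alpha_1(\Psi):=\inf_{\boldsymbol R}\mathbb E[\boldsymbol R(0)^\alpha]$ over all of them ($0^0:=0$), and $\mathrm{udim}_H(\Psi):=\sup\{\alpha\ge0:\mathcal H^\alpha_1(\Psi)=0\}$, $\sup\emptyset:=0$. *)

(* Defs.v *)
From HB Require Import structures.
From mathcomp Require Import all_boot all_order all_algebra.
From mathcomp Require Import all_classical all_reals all_analysis measurable_realfun.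

Set Implicit Arguments.
Unset Strict Implicit.
Unset Printing Implicit Defensive.

Import Order.TTheory GRing.Theory Num.Theory.
Import numFieldNormedType.Exports.

Local Open Scope classical_set_scope.
Local Open Scope ring_scope.

(* Only finite subfamilies are constrained; int carries the discrete
   sigma-algebra, so the B j are arbitrary. *)
Definition mutually_independent {R : realType} {d : measure_display}
    {T : measurableType d} (P : probability T R) (I : eqType)
    (X : I -> T -> int) : Prop :=
  forall (J : seq I) (B : I -> set int), uniq J ->
    P (\bigcap_(j in [set` J]) [set w | B j (X j w)]) =
    (\prod_(j <- J) P [set w | B j (X j w)])%E.

Record double_sided_simple_walk {R : realType} {d : measure_display}
    {T : measurableType d} (P : probability T R) (S : int -> T -> int) : Prop := {
  walk_measurable : forall n k : int, measurable [set w | S n w = k] ;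
  walk_start : forall w, S 0 w = 0 ;
  walk_jump_up : forall n : int, P [set w | S n w - S (n - 1) w = 1] = (2^-1)%:E ;
  walk_jump_down : forall n : int,
    P [set w | S n w - S (n - 1) w = - 1] = (2^-1)%:E ;
  walk_jumps_independent :
    mutually_independent P (fun (n : int) w => S n w - S (n - 1) w) }.

Definition zero_set (R : realType) (T : Type) (S : int -> T -> int) (w : T) : set R :=
  [set n%:~R | n in [set n : int | S n w = 0]].

Arguments zero_set R {T} S w.

(* Configurations of points in X, with the usual sigma-algebra of point-process
   theory: the one generated by the counting maps phi |-> #(phi `&` B). *)
Definition count_events {d : measure_display} (X : measurableType d) :
    set (set (set X)) :=
  [set E | exists B : set X, measurable B /\
     exists n : nat, E = [set phi | (phi `&` B #= `I_n)%card]].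

Definition config {d : measure_display} (X : measurableType d) :=
  g_sigma_algebraType (@count_events d X).

Definition locally_finite {R : realType} (phi : set R) : Prop :=
  forall K : set R, compact K -> finite_set (phi `&` K).

Definition translate {R : realType} (t : R) (phi : set R) : set R :=
  [set x + t | x in phi].

(* A configuration phi together with a marking z in Xi^(phi x phi), encoded as
   the configuration {(x, y, z x y) | x, y in phi}; the values of z outside
   phi x phi are junk and do not matter.  For fixed phi the trace of the counting
   sigma-algebra is the product sigma-algebra of Xi^(phi x phi). *)
Definition marked {R : realType} {dX : measure_display} {Xi : measurableType dX}
    (phi : set R) (z : R -> R -> Xi) : config (R * R * Xi)%type :=
  [set p : R * R * Xi | [/\ phi p.1.1, phi p.1.2 & p.2 = z p.1.1 p.1.2]].

(* The marking of phi is the random element ep_mark phi of Xi^(phi x phi) on the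
   space of extra randomness ep_prob; only its law for each fixed phi matters.
   "Almost every realization" is the translation-invariant set ep_dom of full
   measure.  Xi is bool or (a subset of) R below. *)
Record equivariant_process {R : realType} {d : measure_display}
    {T : measurableType d} (P : probability T R) (Psi : T -> set R)
    {dX : measure_display} (Xi : measurableType dX) := {
  ep_disp : measure_display ;
  ep_space : measurableType ep_disp ;
  ep_prob : probability ep_space R ;
  ep_dom : set (config R) ;
  ep_mark : set R -> R -> R -> ep_space -> Xi ;
  ep_dom_measurable : measurable ep_dom ;
  ep_dom_locally_finite : forall phi, ep_dom phi -> locally_finite phi ;
  ep_dom_translate : forall (t : R) phi, ep_dom phi -> ep_dom (translate t phi) ;
  ep_dom_full : P [set w | ep_dom (Psi w)] = 1%E ;
  ep_mark_random : forall (phi : set R) (x y : R), ep_dom phi -> phi x -> phi y ->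
    measurable_fun setT (ep_mark phi x y) ;
  ep_mark_measurable : forall A : set (config (R * R * Xi)%type), measurable A ->
    measurable_fun ep_dom (fun phi : config R =>
      ep_prob [set u | A (marked phi (fun x y => ep_mark phi x y u))]) ;
  ep_equivariant : forall (t : R) (phi : set R), ep_dom phi ->
    forall A : set (config (R * R * Xi)%type), measurable A ->
      ep_prob [set u | A (marked (translate t phi)
                            (fun x y => ep_mark phi (x - t) (y - t) u))] =
      ep_prob [set u | A (marked (translate t phi)
                            (fun x y => ep_mark (translate t phi) x y u))] }.

Arguments ep_mark {R d T P Psi dX Xi} _ _ _ _ _.

Definition nball {R : realType} (phi : set R) (r v : R) : set R :=
  if r == 0 then set0 else phi `&` [set x | `|x - v| <= r].

Section dimensions.
Context {R : realType} {d : measure_display} {T : measurableType d}.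
Variables (P : probability T R) (Psi : T -> set R).

(* Points with mark 1 (true). *)
Definition ep_subset (Z : equivariant_process P Psi bool) (phi : set R)
    (u : ep_space Z) : set R :=
  [set x | phi x /\ ep_mark Z phi x x u = true].

Arguments ep_subset : clear implicits.

(* The extra randomness is independent of Psi, so probabilities and expectations
   are iterated.  ep_mark is unconstrained off ep_dom, hence the null complement of
   {Psi in ep_dom} is left out of the outer integral. *)
Definition intensity (Z : equivariant_process P Psi bool) : \bar R :=
  (\int[P]_(w in [set w | ep_dom Z (Psi w)])
     ep_prob Z [set u | ep_subset Z (Psi w) u 0%R])%E.

Definition is_r_covering (r : R) (Z : equivariant_process P Psi bool) : Prop :=
  {ae P, forall w, {ae ep_prob Z, forall u,
    Psi w `<=` \bigcup_(v in ep_subset Z (Psi w) u) nball (Psi w) r v}}.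

Definition lambda (r : R) : \bar R :=
  ereal_inf [set l | exists2 Z, is_r_covering r Z & l = intensity Z].

(* udim_M(Psi) exists and equals l. *)
Definition udimM_is (l : \bar R) : Prop :=
  ((- lne (lambda r)) * ((ln r)^-1)%:E)%E @[r --> +oo] --> l.

Definition is_covering (Z : equivariant_process P Psi R) : Prop :=
  (forall (phi : set R) (x y : R) (u : ep_space Z), ep_dom Z phi -> phi x -> phi y ->
     ep_mark Z phi x y u = 0 \/ 1 <= ep_mark Z phi x y u) /\
  {ae P, forall w, {ae ep_prob Z, forall u,
    Psi w `<=` \bigcup_(v in Psi w) nball (Psi w) (ep_mark Z (Psi w) v v u) v}}.

(* powR has 0 `^ 0 = 1, whereas 0^0 is 0 here. *)
Definition pow0 (x a : R) : R := if x == 0 then 0 else x `^ a.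

Definition mean_radius_pow (alpha : R) (Z : equivariant_process P Psi R) : \bar R :=
  (\int[P]_(w in [set w | ep_dom Z (Psi w)])
     \int[ep_prob Z]_u (pow0 (ep_mark Z (Psi w) 0 0 u)%R alpha)%:E)%E.

Definition hausdorff1 (alpha : R) : \bar R :=
  ereal_inf [set h | exists2 Z, is_covering Z & h = mean_radius_pow alpha Z].

(* All alpha are nonnegative, so adding 0 only serves to make the supremum of the empty set 0. *)
Definition udimH : \bar R :=
  ereal_sup (0%E |` [set alpha%:E | alpha in
    [set alpha : R | 0 <= alpha /\ hausdorff1 alpha = 0%E]]).

End dimensions.

(* Main.v *)
(** Lower bounds on coverings come from mass transport.  For [alpha > 1/2] call a
    zero tame if every ball of radius [2 ^ k] around it has at most
    [M 2 ^ (k alpha)] zeros; since [P (S_n = 0) <= (|n| + 1) ^ (-1/2)], Markov's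
    inequality and a geometric series make the origin tame with probability at
    least [1/2] for [M] large.  Given a covering [R], let every tame zero send mass
    1 to each centre whose ball contains it.  Each tame zero sends at least 1, while
    a centre [v] receives at most [M 4 ^ alpha (R v) ^ alpha], because its ball lies
    in a ball of comparable radius around any of its tame points.  The law of the
    path is invariant under shifts, so expected masses sent and received agree and
    [E (R 0) ^ alpha >= 1 / (2 M 4 ^ alpha)].  Constant radii give
    [lambda_r >= c r ^ (- alpha)].

    For the upper bounds, cut the line into cells of [N] consecutive lattice points
    with a uniform random offset and keep the last zero of each cell.  The intensity
    is the average over [s < N] of [P (S_1, ..., S_s <> 0) = O ((s + 1) ^ (-1/2))],
    hence [lambda_r = O (r ^ (-1/2))], and [r ^ alpha lambda_r] tends to 0 for
    [alpha < 1/2]. *)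

Require Import Defs.
From HB Require Import structures.
From mathcomp Require Import all_boot all_order all_algebra.
From mathcomp Require Import all_classical all_reals all_analysis measurable_realfun.
From mathcomp Require Import zify ring lra.
Import Order.TTheory GRing.Theory Num.Theory.
Import numFieldNormedType.Exports.
Local Open Scope classical_set_scope.
Local Open Scope ring_scope.

(** * Counting simple walks *)

(* The number of n-step walks started at x that end at 0. *)
Fixpoint hits (n : nat) (x : int) : nat :=
  if n is n'.+1 then (hits n' (x + 1)%R + hits n' (x - 1)%R)%N else (x == 0).

(* The number of n-step walks started at x whose positions after each step are nonzero. *)
Fixpoint avoids (n : nat) (x : int) : nat :=
  if n is n'.+1 then
    ((x + 1 != 0)%R * avoids n' (x + 1)%R + (x - 1 != 0)%R * avoids n' (x - 1)%R)%N
  else 1%N.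

Lemma hitsN n x : hits n (- x) = hits n x.
Proof.
elim: n x => [|n IH] x /=; first by rewrite oppr_eq0.
by rewrite -(IH (x + 1)) -(IH (x - 1)) addnC; congr (hits n _ + hits n _)%N; ring.
Qed.

(* 'C(n, k) sequences have exactly k positive steps. *)
Lemma hits_bin n (k : nat) : hits n ((n%:Z - k%:Z *+ 2)) = 'C(n, k).
Proof.
elim: n k => [|n IH] [|k] /=.
- by [].
- by rewrite bin0n.
- rewrite bin0 -[RHS](bin0 n) -(IH 0%N).
  have -> m y : (m%:Z < y)%R -> hits m y = 0%N.
    elim: m y => [|m IHm] y my /=; first by rewrite (_ : (_ == 0 :> int) = false) //; lia.
    by rewrite !IHm //; lia.
  - by rewrite add0n; congr hits; lia.
  - by lia.
- by rewrite binS -!IH addnC; congr (hits n _ + hits n _)%N; lia.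
Qed.

Lemma hits_odd n (x : int) : odd (n + `|x|%N) -> hits n x = 0%N.
Proof.
elim: n x => [|n IH] x /= ox; first by case: eqP ox => // ->.
by rewrite !IH //; lia.
Qed.

Lemma hitsS n x : hits n.+1 x = (hits n (x + 1) + hits n (x - 1))%N.
Proof. by []. Qed.

Local Arguments double : simpl never.
Local Arguments hits : simpl never.

(* Reflection principle: both sides satisfy the recursion of walks killed at 0. *)
Lemma avoids_pos n (a : nat) : (0 < a)%N ->
  avoids n a = (\sum_(0 <= i < a.*2) hits n (i%:Z - a%:Z + 1))%N /\
  avoids n (- a%:Z) = (\sum_(0 <= i < a.*2) hits n (i%:Z - a%:Z + 1))%N.
Proof.
(* [hits] is summed over the [2a] heights in [(-a, a]]. *)
pose g n (a : nat) := (\sum_(0 <= i < a.*2) hits n (i%:Z - a%:Z + 1))%N.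
(* A step up or down moves the heights in [(-b-1, b+1]] to [(-b, b+2]] or [(-b-2, b]]. Counted with
   multiplicity, these are the heights in [(-b-2, b+2]] and [(-b, b]]. *)
have gS m (b : nat) : g m.+1 b.+1 = (g m b.+2 + g m b)%N.
  rewrite /g; under eq_bigr => i _ do rewrite hitsS.
  rewrite big_split /= addnC.
  have -> : (\sum_(0 <= i < b.+2.*2) hits m (i%:Z - b.+2%:Z + 1)%R =
    \sum_(0 <= i < b.+1.*2) hits m (i%:Z - b.+1%:Z + 1 - 1)%R +
     (hits m (b.+1%:Z) + hits m b.+2%:Z))%N.
    rewrite (doubleS b.+1) 2?big_nat_recr //= -addnA; congr (_ + (_ + _))%N.
    - by apply: eq_bigr => i _; congr hits; lia.
    - by congr hits; lia.
    - by congr hits; lia.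
  rewrite -addnA; congr (_ + _)%N.
  rewrite doubleS 2?big_nat_recr //= [RHS]addnC addnA; congr (_ + _ + _)%N.
  - by apply: eq_bigr => i _; congr hits; lia.
  - by congr hits; lia.
  - by congr hits; lia.
have g1 m : g 0%N m.+1 = 1%N.
  have mm : (m < m.+1.*2)%N by lia.
  rewrite /g big_mkord (bigD1 (Ordinal mm)) //= big1 ?addn0.
    by rewrite /hits (_ : (_ == 0 :> int) = true) //; lia.
  move=> i; rewrite -val_eqE /= => im.
  by rewrite /hits (_ : (_ == 0 :> int) = false) //; lia.
elim: n a => [|n IH] [//|a] _; rewrite -/(g _ _); first by rewrite g1.
rewrite gS /=.
have -> : a.+1%:Z + 1 = a.+2%:Z by lia.
have -> : a.+1%:Z - 1 = a%:Z by lia.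
have -> : - a.+1%:Z + 1 = - a%:Z by lia.
have -> : - a.+1%:Z - 1 = - a.+2%:Z by lia.
rewrite oppr_eq0.
have [-> ->] := IH a.+2 isT; rewrite -/(g _ _) !mul1n.
(* From height 1 the step down hits 0 and is killed, in agreement with the empty sum [g n 0]. *)
case: a => [|a]; first by rewrite !mul0n [g n 0%N]big_geq // add0n addn0.
have [-> ->] := IH a.+1 isT; rewrite -/(g _ _).
by rewrite mul1n addnC.
Qed.

(** The first step leads to 1 or -1, where the reflection formula has only the two terms at heights
    0 and 1. *)
Lemma avoids0 n : avoids n.+1 0 = (hits n 0 + hits n 1).*2.
Proof.
rewrite /= add0r sub0r.
have [-> ->] := avoids_pos n 1 isT.
by rewrite !mul1n addnn !big_nat_recr // big_geq //= add0n.
Qed.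

(** The estimate [C(2m, m) <= 4^m / sqrt (2m+1)], squared so as to stay in the naturals. By the
    ratio of consecutive central binomials, the induction step reduces to
    [(2m+1)(2m+3) <= (2m+2)^2]. *)
Lemma central_bin_le m : ('C(m.*2, m) ^ 2 * m.*2.+1 <= 16 ^ m)%N.
Proof.
elim: m => [//|m IH].
have bS : (m.+1 * 'C(m.+1.*2, m.+1) = m.*2.+1.*2 * 'C(m.*2, m))%N.
  have h1 := mul_bin_diag m.*2.+2 m; have h2 := mul_bin_diag m.*2.+1 m.
  have h3 : 'C(m.*2.+1, m.+1) = 'C(m.*2.+1, m).
    by rewrite -(@bin_sub m.*2.+1 m); [congr binomial; lia|lia].
  rewrite /= h3 in h2; rewrite /= in h1.
  have h4 : (m.+1 * 'C(m.*2.+2, m.+1) = m.*2.+2 * 'C(m.*2.+1, m))%N by [].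
  rewrite doubleS h4.
  have -> : (m.*2.+2 = 2 * m.+1)%N by lia.
  by rewrite -mulnA -h2; lia.
rewrite -(@leq_pmul2l (m.+1 ^ 2)) ?expn_gt0 // mulnA -expnMn bS.
rewrite expnMn (expnS 16) [(_ * (16 * _))%N]mulnCA [(16 * (_ * _))%N]mulnA.
move: IH; set c := 'C(m.*2, m); set s := (16 ^ m)%N => IH.
have : (m.*2.+1.*2 * m.+1.*2.+1 * 2 <= 16 * m.+1 ^ 2)%N by nia.
move=> h; have := leq_mul h IH.
have -> : (m.*2.+1.*2 ^ 2 * c ^ 2 * m.+1.*2.+1 =
  m.*2.+1.*2 * m.+1.*2.+1 * 2 * (c ^ 2 * m.*2.+1))%N by lia.
by [].
Qed.

(** * Inverse square root bounds on the counts *)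

Section bounds.
Variable R : realType.

Lemma hits0_le n : (hits n 0)%:R / 2 ^+ n <= (Num.sqrt n.+1%:R)^-1 :> R.
Proof.
have [on|en] := boolP (odd n); first by rewrite hits_odd ?addn0 // mul0r invr_ge0 sqrtr_ge0.
have -> : n = n./2.*2 by rewrite even_halfK.
set m := n./2.
have := hits_bin m.*2 m.
rewrite (_ : _ - _ = 0); last by lia.
move=> ->; rewrite ler_pdivrMr ?exprn_gt0 // mulrC ler_pdivlMr ?sqrtr_gt0 ?ltr0n //.
rewrite -(ler_pXn2r (ltn0Sn 1)) ?nnegrE ?mulr_ge0 ?sqrtr_ge0 ?exprn_ge0 //.
rewrite exprMn sqr_sqrtr // -exprM -!natrX -natrM ler_nat.
by apply: leq_trans (central_bin_le m) _; rewrite -muln2 -mulnA mulnC expnM.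
Qed.

(** By reflection, [avoids (n+1) 0] is [2 hits n 0 + hits (n+1) 0]. The constant 3 is 2 + 1, the 2
    paying for the replacement of [n+1] by [n+2] under the root. *)
Lemma avoids0_le n : (avoids n 0)%:R / 2 ^+ n <= 3 * (Num.sqrt n.+1%:R)^-1 :> R.
Proof.
case: n => [|n]; first by rewrite sqrtr1 expr0 !invr1 !mulr1 ler_nat.
have -> : avoids n.+1 0 = (2 * hits n 0 + hits n.+1 0)%N.
rewrite avoids0 hitsS add0r sub0r (hitsN n 1). by rewrite addnn doubleD mul2n.
have -> : (2 * hits n 0 + hits n.+1 0)%N%:R / 2 ^+ n.+1 =
    (hits n 0)%:R / 2 ^+ n + (hits n.+1 0)%:R / 2 ^+ n.+1 :> R.
  rewrite natrD natrM exprS invfM; field.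
  by rewrite expf_neq0.
have sp k : 0 < Num.sqrt k.+1%:R :> R by rewrite sqrtr_gt0 ltr0n.
have h : (Num.sqrt n.+1%:R)^-1 <= 2 * (Num.sqrt n.+2%:R)^-1 :> R.
  rewrite ler_pdivlMr // mulrC ler_pdivrMr //.
  rewrite -(ler_pXn2r (ltn0Sn 1)) ?nnegrE ?mulr_ge0 ?sqrtr_ge0 //.
  by rewrite exprMn !sqr_sqrtr // -natrX -natrM ler_nat; lia.
apply: le_trans (lerD (hits0_le n) (hits0_le n.+1)) _.
by have := sp n; have := sp n.+1; lra.
Qed.

Lemma sum_invsqrt_le n : \sum_(i < n) (Num.sqrt i.+1%:R)^-1 <= 2 * Num.sqrt n%:R :> R.
Proof.
elim: n => [|n IH]; first by rewrite big_ord0 mulr_ge0 ?sqrtr_ge0.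
rewrite big_ord_recr /=.
apply: le_trans (lerD IH (lexx _)) _.
have s0 : 0 <= Num.sqrt n%:R :> R by exact: sqrtr_ge0.
have s1 : 0 < Num.sqrt n.+1%:R :> R by rewrite sqrtr_gt0 ltr0n.
have : Num.sqrt n.+1%:R ^+ 2 = Num.sqrt n%:R ^+ 2 + 1 :> R.
  by rewrite !sqr_sqrtr // -natr1.
move: s0 s1; set x := Num.sqrt n%:R; set y := Num.sqrt _ => x0 y0 xy.
rewrite -(ler_pM2l y0) mulrDr mulfV ?gt_eqF //.
(* Since [y^2 = x^2 + 1], the claim [2xy + 1 <= 2y^2] says that [(y - x)^2] is nonnegative. *)
by have : 0 <= (y - x) ^+ 2; [exact: sqr_ge0|nra].
Qed.

End bounds.

(** * The law of the path *)

Lemma measurable_bigcup_countType {d} {T : measurableType d} {I : countType}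
    (D : set I) (F : I -> set T) :
  (forall i, D i -> measurable (F i)) -> measurable (\bigcup_(i in D) F i).
Proof.
move=> mF; rewrite bigcup_mkcond; apply: countable_bigcupT_measurable => // i.
by case: ifPn => [/set_mem/mF|].
Qed.

Lemma measurable_bigcap_countType {d} {T : measurableType d} {I : countType}
    (D : set I) (F : I -> set T) :
  (forall i, D i -> measurable (F i)) -> measurable (\bigcap_(i in D) F i).
Proof.
move=> mF; rewrite -[X in measurable X]setCK setC_bigcap; apply: measurableC.
by apply: measurable_bigcup_countType => i /mF; exact: measurableC.
Qed.

HB.instance Definition _ := isPointed.Build int 0.

Definition jump (s : int -> int) (k : int) : int := s k - s (k - 1).

(* Only increments are observed: the height s 0 of a path is not an event, and the
   zeros of s are the n with s n - s 0 = 0. *)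
Definition cylinder (J : seq int) (B : int -> set int) : set (int -> int) :=
  [set s | forall k, k \in J -> B k (jump s k)].

Definition cylinders : set (set (int -> int)) :=
  [set C | exists J B, C = cylinder J B].

Definition paths := g_sigma_algebraType cylinders.

(** The shifted path is not brought back to height 0 at time 0; this is harmless because events see
    increments only. *)
Definition shift_path (m : int) (s : int -> int) : int -> int := fun n => s (n + m).

Lemma cylinders_setI : setI_closed cylinders.
Proof.
move=> _ _ [J [B ->]] [J' [B' ->]].
exists (J ++ J'), (fun k => [set x | (k \in J -> B k x) /\ (k \in J' -> B' k x)]).
apply/seteqP; split=> s /=.
  move=> [h h'] k; rewrite mem_cat => _; split; [exact: h|exact: h'].
move=> h; split=> k kJ; have := h k; rewrite mem_cat kJ ?orbT /= => /(_ isT) [].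
  by move=> /(_ isT).
by move=> _ /(_ isT).
Qed.

Lemma measurable_cylinder J B : measurable (cylinder J B : set paths).
Proof. by apply: sub_sigma_algebra; exists J, B. Qed.

(** The generators see single jumps, so longer displacements are built up one jump at a time, by a
    countable union over the previous value. *)
Lemma measurable_displacement (i j x : int) :
  measurable ([set s | s j - s i = x] : set paths).
Proof.
suff H (n : nat) (k y : int) : measurable ([set s | s (k + n%:Z) - s k = y] : set paths).
  have [ij|/ltW ij] := leP i j.
    have -> : j = i + `|j - i|%N%:Z by lia.
    exact: H.
  have -> : i = j + `|i - j|%N%:Z by lia.
  rewrite (_ : mkset _ = [set s | s (j + `|i - j|%N%:Z) - s j = - x]); first exact: H.
  by apply/seteqP; split=> s /=; lia.
elim: n y => [|n IH] y.
  have [->|y0] := eqVneq y 0.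
    rewrite (_ : mkset _ = setT); first exact: measurableT.
    by apply/seteqP; split=> s //= _; rewrite addr0 subrr.
  rewrite (_ : mkset _ = set0); first exact: measurable0.
  by apply/seteqP; split=> s //=; rewrite addr0 subrr => /esym/eqP; rewrite (negbTE y0).
rewrite (_ : mkset _ = \bigcup_(z in [set: int])
   ([set s | s (k + n%:Z) - s k = z] `&`
    cylinder [:: k + n.+1%:Z] (fun=> [set y - z]))).
  apply: measurable_bigcup_countType => z _; apply: measurableI; first exact: IH.
  exact: measurable_cylinder.
have e : k + n.+1%:Z - 1 = k + n%:Z by lia.
apply/seteqP; split=> s /=.
  move=> h; exists (s (k + n%:Z) - s k) => //; split => // l; rewrite inE => /eqP ->.
  by rewrite /jump e /=; lia.
move=> [z _ [/= h1 /(_ _ (mem_head _ _))]]; rewrite /jump e /= => h2; lia.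
Qed.

Lemma shift_cylinder m J B : shift_path m @^-1` (cylinder J B) =
  cylinder (map (+%R^~ m) J) (fun k => B (k - m)).
Proof.
apply/seteqP; split=> s /= h k.
  by move=> /mapP[j jJ ->]; rewrite addrK; have := h j jJ; rewrite /jump /shift_path addrAC.
by move=> kJ; have := h (k + m) (map_f _ kJ); rewrite addrK /jump /shift_path addrAC.
Qed.

Lemma measurable_shift m : measurable_fun setT (shift_path m : paths -> paths).
Proof.
apply: (measurability (cylinders : set (set paths))) => // _ [_ [J [B ->]] <-].
by rewrite setTI shift_cylinder; exact: measurable_cylinder.
Qed.

Definition walk_path {T : Type} (S : int -> T -> int) (w : T) : paths := S^~ w.

Section walk.
Context {R : realType} {d : measure_display} {T : measurableType d}.
Context {P : probability T R} {S : int -> T -> int}.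
Hypothesis hS : double_sided_simple_walk P S.

Let pth : T -> paths := walk_path S.

Lemma measurable_jump_event k (B : set int) :
  measurable [set w | B (jump (pth w) k)].
Proof.
rewrite (_ : mkset _ = \bigcup_(x in [set: int]) \bigcup_(y in [set y | B (x - y)])
   ([set w | S k w = x] `&` [set w | S (k - 1) w = y])).
  apply: measurable_bigcup_countType => x _; apply: measurable_bigcup_countType => y _.
  by apply: measurableI; exact: (walk_measurable hS).
apply/seteqP; split=> w /=.
  by move=> h; exists (S k w) => //; exists (S (k - 1) w).
by move=> [x _ [y Bxy [Hx Hy]]]; rewrite /jump /pth /walk_path Hx Hy.
Qed.

Lemma measurable_path : measurable_fun setT pth.
Proof.
apply: (measurability (cylinders : set (set paths))) => // _ [_ [J [B ->]] <-]; rewrite setTI.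
rewrite (_ : _ @^-1` _ = \bigcap_(k in [set` J]) [set w | B k (jump (pth w) k)]) //.
by apply: measurable_bigcap_countType => k _; exact: measurable_jump_event.
Qed.

(** The two values 1 and -1 have probability 1/2 each, so every other value of the jump is a null
    event. *)
Lemma jump_split k (E : set T) : measurable E ->
  P E = (P (E `&` [set w | jump (pth w) k = 1%R]) +
         P (E `&` [set w | jump (pth w) k = (- 1)%R]))%E.
Proof.
move=> mE.
have mJ x : measurable [set w | jump (pth w) k = x].
  exact: (measurable_jump_event k [set x]).
set U := [set w | _ = 1%R]; set D := [set w | _ = (-1)%R].
have mU : measurable U by exact: mJ.
have mD : measurable D by exact: mJ.
have UD : U `&` D = set0.
  by apply/seteqP; split=> w // -[hU]; rewrite /D /mkset hU.
have PUD : P (~` (U `|` D)) = 0%E.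
  rewrite probability_setC; last exact: measurableU.
  have -> : P (U `|` D) = (P U + P D)%E by rewrite measureU.
  have -> : P U = (2^-1)%:E := walk_jump_up hS k.
  have -> : P D = (2^-1)%:E := walk_jump_down hS k.
  have h1 : 2^-1 + 2^-1 = 1 :> R by lra.
  by rewrite -EFinD h1 subrr.
rewrite (measureDI _ mE mU) addeC; congr (_ + _)%E.
rewrite (measureDI _ (measurableD mE mU) mD).
rewrite (subset_measure0 (B := ~` (U `|` D))) ?add0e //.
- congr (P _); apply/seteqP; split=> w /=; first by move=> [[]].
  by move=> [Ew Dw]; split=> //; split=> // Uw; have : (U `&` D) w by []; rewrite UD.
- by apply: measurableD => //; exact: measurableD.
- by apply: measurableC; exact: measurableU.
- by move=> w [[_ Uw] Dw] [].
Qed.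

Lemma jump_law k (B : set int) : P [set w | B (jump (pth w) k)] =
  (2^-1 * `[< B 1 >]%:R + 2^-1 * `[< B (- 1)>]%:R)%:E.
Proof.
have H x : P [set w | jump (pth w) k = x] = (2^-1)%:E ->
    P ([set w | B (jump (pth w) k)] `&` [set w | jump (pth w) k = x]) =
    (2^-1 * `[< B x >]%:R)%:E.
  move=> Hx; case: asboolP => Bx.
    rewrite mulr1 -Hx; congr (P _); apply/seteqP; split=> w /=; first by case.
    by move=> h; rewrite h.
  rewrite mulr0 (_ : _ `&` _ = set0) ?measure0 //.
  by apply/seteqP; split=> w //= [+ h]; rewrite h.
rewrite (jump_split k _ (measurable_jump_event _ _)) EFinD; congr (_ + _)%E; apply: H.
- exact: (walk_jump_up hS).
- exact: (walk_jump_down hS).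
Qed.

Lemma measurable_path_shift m : measurable_fun setT (shift_path m \o pth : T -> paths).
Proof. apply: measurableT_comp; [exact: measurable_shift|exact: measurable_path]. Qed.

Lemma cylinder_law J B : uniq J -> P (pth @^-1` (cylinder J B)) =
  (\prod_(k <- J) (2^-1 * `[< B k 1 >]%:R + 2^-1 * `[< B k (- 1)>]%:R)%:E)%E.
Proof.
move=> uJ; rewrite (_ : _ @^-1` _ =
  \bigcap_(k in [set` J]) [set w | B k (jump (pth w) k)]) //.
rewrite (walk_jumps_independent hS B uJ).
by apply: eq_bigr => k _; exact: jump_law.
Qed.

(** Cylinders are stable under intersection and generate, so it is enough to compare their
    probabilities; the product formula for these does not see where the indices lie. *)
Lemma shift_invariant m (E : set paths) : measurable E ->
  P (pth @^-1` (shift_path m @^-1` E)) = P (pth @^-1` E).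
Proof.
move=> mE.
pose f1 : {mfun T >-> paths} := mfun_Sub (mem_set (measurable_path_shift m)).
pose f2 : {mfun T >-> paths} := mfun_Sub (mem_set measurable_path).
apply: (measure_unique (cylinders : set (set paths)) (fun=> setT) _ cylinders_setI _ _
  (distribution P f1) (distribution P f2)) => //.
- by move=> _; exists [::], (fun=> setT); apply/seteqP; split.
- exact: bigcup_const.
- move=> _ [J [B ->]]; 
  change (P (pth @^-1` (shift_path m @^-1` cylinder J B)) = P (pth @^-1` cylinder J B)).
  (* Independence is stated for lists without repetitions. *)
  rewrite (_ : cylinder J B = cylinder (undup J) B); last first.
    by apply/seteqP; split=> s h k kJ; apply: h; move: kJ; rewrite mem_undup.
  rewrite shift_cylinder !cylinder_law ?undup_uniq //; last first.
    by rewrite map_inj_uniq ?undup_uniq //; exact: addIr.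
  by rewrite big_map; apply: eq_bigr => k _; rewrite addrK.
- move=> _; change (P (f1 @^-1` setT) < +oo)%E.
  by rewrite preimage_setT probability_setT ltry.
Qed.
End walk.

(** * Probabilities of path events as counts of walks *)

Lemma measurable_displacement_in (i j : int) (B : set int) :
  measurable ([set s | B (s j - s i)] : set paths).
Proof.
rewrite (_ : mkset _ = \bigcup_(x in B) ([set s | s j - s i = x])).
  by apply: measurable_bigcup_countType => x _; exact: measurable_displacement.
by apply/seteqP; split=> s /=; [move=> h; exists (s j - s i)|move=> [x Bx /= ->]].
Qed.

Definition sgnb (b : bool) : int := if b then 1 else -1.

Definition starts_with (t : seq bool) : set (int -> int) :=
  cylinder [seq k.+1%:Z | k <- iota 0 (size t)]
    (fun k => [set sgnb (nth false t `|k|%N.-1)]).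

Lemma starts_withP t (s : int -> int) :
  starts_with t s <-> forall k, (k < size t)%N -> jump s k.+1%:Z = sgnb (nth false t k).
Proof.
split=> [h k kt|h j /mapP[k]].
  by apply: (h k.+1%:Z); apply/mapP; exists k => //; rewrite mem_iota.
by rewrite mem_iota add0n => /andP[_ kt] ->; exact: h.
Qed.

Lemma starts_with_rcons t b : starts_with (rcons t b) =
  starts_with t `&` [set s | jump s (size t).+1%:Z = sgnb b].
Proof.
apply/seteqP; split=> s.
  move=> /starts_withP h; split.
    apply/starts_withP => k kt; rewrite h ?size_rcons 1?ltnW //.
    by rewrite nth_rcons kt.
  by rewrite /= h ?size_rcons // nth_rcons ltnn eqxx.
move=> [/starts_withP h /= hb]; apply/starts_withP => k.
rewrite size_rcons ltnS leq_eqVlt nth_rcons => /orP[/eqP ->|kt].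
  by rewrite ltnn eqxx.
by rewrite kt; exact: h.
Qed.

(** A common form of [hits] and [avoids]: [w] constrains the position after every step, [v] the last
    position. *)
Fixpoint count_paths (w v : pred int) (n : nat) (x : int) : nat :=
  if n is n'.+1 then (w (x + 1)%R * count_paths w v n' (x + 1)%R +
                      w (x - 1)%R * count_paths w v n' (x - 1)%R)%N
  else v x.

Lemma count_paths_hits n x : count_paths predT (pred1 0) n x = hits n x.
Proof. by elim: n x => [|n IH] x //=; rewrite !IH !mul1n. Qed.

Lemma count_paths_avoids n x : count_paths (predC1 0) predT n x = avoids n x.
Proof. by elim: n x => [|n IH] x //=; rewrite !IH. Qed.

Definition window (w v : pred int) (n m : nat) : set (int -> int) :=
  [set s | (forall k, (n < k <= n + m)%N -> w (s k%:Z - s 0)) /\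
           v (s (n + m)%N%:Z - s 0)].

Lemma measurable_window w v n m : measurable (window w v n m : set paths).
Proof.
rewrite (_ : window w v n m =
  \bigcap_(k in [set k | (n < k <= n + m)%N]) [set s | [set x | w x] (s k%:Z - s 0)]
  `&` [set s | [set x | v x] (s (n + m)%N%:Z - s 0)]) //.
apply: measurableI; last exact: measurable_displacement_in.
by apply: measurable_bigcap_countType => k _; exact: measurable_displacement_in.
Qed.

Section walk.
Context {R : realType} {d : measure_display} {T : measurableType d}.
Context {P : probability T R} {S : int -> T -> int}.
Hypothesis hS : double_sided_simple_walk P S.

Let pth : T -> paths := walk_path S.

Lemma measurable_path_preimage (E : set paths) :
  measurable E -> measurable (pth @^-1` E).
Proof. by move=> mE; rewrite -[_ @^-1` _]setTI; exact: (measurable_path hS). Qed.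

Lemma starts_with_law t : P (pth @^-1` (starts_with t)) = (2 ^- size t)%:E.
Proof.
rewrite (cylinder_law hS); last first.
  by rewrite map_inj_uniq ?iota_uniq // => i j; lia.
rewrite big_map (eq_bigr (fun=> (2^-1)%:E)) => [|k _].
  rewrite big_const_seq /= count_predT size_iota -exprVn.
  by elim: (size t) => //= n ->; rewrite exprS EFinM.
congr (_%:E).
by case: nth; rewrite ?(asboolT (P := 1 = 1)) ?(asboolT (P := -1 = -1)) //
 ?(asboolF (P := 1 = -1)) // ?(asboolF (P := -1 = 1)) //= mulr1 mulr0 ?addr0 ?add0r.
Qed.

(** Induction on the number [m] of remaining steps: splitting by the next jump lengthens the
    prescribed prefix [t] by one letter, which reproduces the recursion of [count_paths]. *)
Lemma window_law w v m t (x : int) :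
  (forall s, starts_with t s -> s (size t)%:Z - s 0 = x) ->
  P (pth @^-1` (starts_with t `&` window w v (size t) m)) =
  ((count_paths w v m x)%:R / 2 ^+ (size t + m))%:E.
Proof.
elim: m t x => [|m IH] t x tx.
  have [vx|vx] := boolP (v x).
    rewrite /= vx mul1r addn0 -starts_with_law; congr (P _).
    apply/seteqP; split=> u /=; first by case.
    move=> h; split=> //; split=> [k|].
      by rewrite addn0 => /andP[+ /leq_ltn_trans h']; move=> /h'; rewrite ltnn.
    by rewrite addn0 tx.
  rewrite /= (negbTE vx) mul0r (_ : _ @^-1` _ = set0) ?measure0 //.
  by apply/seteqP; split=> u //= [h [_]]; rewrite addn0 tx // (negbTE vx).
rewrite (jump_split hS (size t).+1%:Z); last first.
  apply: measurable_path_preimage; apply: measurableI; last exact: measurable_window.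
  exact: measurable_cylinder.
have step b : P ((pth @^-1` (starts_with t `&` window w v (size t) m.+1)) `&`
     [set u | jump (pth u) (size t).+1%:Z = sgnb b]) =
   ((w (x + sgnb b)%R * count_paths w v m (x + sgnb b)%R)%N%:R / 2 ^+ (size t + m.+1))%:E.
  have tbx s : starts_with (rcons t b) s -> s (size (rcons t b))%:Z - s 0 = x + sgnb b.
    rewrite starts_with_rcons => -[/tx <- /= <-]; rewrite size_rcons /jump.
    by rewrite (_ : (size t).+1%:Z - 1 = (size t)%:Z); lia.
  have [wx|wx] := boolP (w (x + sgnb b)); last first.
    rewrite mul0n mul0r (_ : _ `&` _ = set0) ?measure0 //.
    apply/seteqP; split=> u //= [[h [h1 h2]] h3].
    have : starts_with (rcons t b) (pth u) by rewrite starts_with_rcons; split.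
    move=> /tbx; rewrite size_rcons => h4.
    by have := h1 (size t).+1; rewrite h4 (negbTE wx) addnS ltnS leqnn leq_addr => /(_ isT).
  rewrite mul1n addnS -addSn -[in RHS](size_rcons t b) -IH //; congr (P _).
  apply/seteqP; split=> u /=.
    move=> [[h [h1 h2]] h3]; split; first by rewrite starts_with_rcons; split.
    split; last by rewrite size_rcons addSnnS.
    by move=> k; rewrite size_rcons addSnnS => /andP[k1 k2]; apply: h1; rewrite k2 andbT ltnW.
  move=> [h]; have h0 := tbx _ h; move: h h0.
  rewrite starts_with_rcons size_rcons => -[h hj] h0 [h1 h2]; split => //; split => //.
  split; last by rewrite -addSnnS.
  move=> k; rewrite leq_eqVlt => /andP[/orP[/eqP <-|k1] k2]; first by rewrite h0.
  by apply: h1; rewrite k1 addSnnS.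
rewrite (step true) (step false) -EFinD; congr (_%:E).
by rewrite -mulrDl -natrD.
Qed.

Lemma prob_zero n : P [set w | S n%:Z w = 0] = ((hits n 0)%:R / 2 ^+ n)%:E.
Proof.
rewrite -count_paths_hits.
rewrite -[n in _ ^+ n]add0n -(window_law _ _ _ [::]) => [|s _]; last by rewrite subrr.
congr (P _); apply/seteqP; split=> u /=.
  move=> h; split=> //; split=> //.
  by rewrite /pth /walk_path add0n h (walk_start hS).
by move=> [_ [_ /eqP]]; rewrite /pth /walk_path add0n (walk_start hS) subr0.
Qed.

Lemma prob_no_return n :
  P [set w | forall k, (0 < k <= n)%N -> S k%:Z w != 0] = ((avoids n 0)%:R / 2 ^+ n)%:E.
Proof.
rewrite -count_paths_avoids.
rewrite -[n in _ ^+ n]add0n -(window_law _ _ _ [::]) => [|s _]; last by rewrite subrr.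
congr (P _); apply/seteqP; split=> u /=.
  move=> h; split=> //; split=> // k /h.
  by rewrite /pth /walk_path (walk_start hS) subr0.
by move=> [_ [h _]] k /h; rewrite /pth /walk_path (walk_start hS) subr0.
Qed.

(** Shifting by [-n] turns the displacement from 0 to [n] into the one from [-n] to 0. *)
Lemma prob_zero_opp (n : int) : P [set w | S (- n) w = 0] = P [set w | S n w = 0].
Proof.
pose E : set paths := [set s | s n - s 0 = 0].
have -> : [set w | S n w = 0] = pth @^-1` E.
  by apply/seteqP; split=> u; rewrite /pth /walk_path /E /= (walk_start hS) subr0.
rewrite -(shift_invariant hS (- n) E); last exact: measurable_displacement.
congr (P _); apply/seteqP; split=> u;
  rewrite /preimage /E /mkset /= /pth /walk_path /shift_path subrr add0r (walk_start hS).
  by move=> ->; rewrite subr0.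
by move/eqP; rewrite sub0r oppr_eq0 => /eqP.
Qed.

Lemma prob_zero_le (n : int) :
  (P [set w | S n w = 0%R] <= ((Num.sqrt `|n|%N.+1%:R)^-1)%:E)%E.
Proof.
have H (k : nat) : (P [set w | S k%:Z w = 0%R] <= ((Num.sqrt k.+1%:R)^-1)%:E)%E.
  by rewrite prob_zero lee_fin hits0_le.
have [n0|n0] := leP 0 n; first by rewrite -{1}(gez0_abs n0); exact: H.
by rewrite -prob_zero_opp -{1}(ltz0_abs n0); exact: H.
Qed.

End walk.

(** * Configurations and marked configurations *)

(** A countable type has only countably many finite subsets, so the event splits according to the
    exact set of indices that occur. *)
Lemma measurable_card {d} {T : measurableType d} {I : countType} (D : set T)
    (E : I -> set T) n : measurable D ->
  (forall i, measurable (D `&` E i)) ->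
  measurable (D `&` [set w | ([set i | E i w] #= `I_n)%card]).
Proof.
move=> mD mE.
rewrite (_ : _ `&` _ = \bigcup_(s in [set s : seq I | ([set` s] #= `I_n)%card])
    (D `&` \bigcap_(i in [set: I]) (D `&` [set w | E i w <-> i \in s]))).
  apply: measurable_bigcup_countType => s _; apply: measurableI => //.
  apply: measurable_bigcap_countType => i _.
  have [si|si] := boolP (i \in s).
    rewrite (_ : _ `&` _ = D `&` E i) //.
    by apply/seteqP; split=> w /= -[Dw h]; split=> //; exact/h.
  rewrite (_ : _ `&` _ = D `\` (D `&` E i)); first exact: measurableD.
  apply/seteqP; split=> w /= -[Dw h]; split=> //.
    by move=> [_ /h]; apply/negP.
  by split=> [Ew|si']; [case: h|case/negP: si].
apply/seteqP; split=> w /=.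
  move=> [Dw h].
  have /finite_seqP[s hs] : finite_set [set i | E i w].
    by apply/finite_setP; exists n.
  exists s; first by rewrite /= -hs.
  by split=> // i _; split=> //=; rewrite -[E i w]/([set i | E i w] i) hs.
move=> [s hs [Dw h]]; split=> //.
rewrite (_ : [set i | E i w] = [set` s]) //.
by apply/seteqP; split=> i /=; have [_ /= hi] := h i Logic.I; move=> /hi.
Qed.

(** Injectivity of the enumeration turns the number of points in [B] into a number of indices, to
    which [measurable_card] applies. *)
Lemma measurable_to_config {d} {T : measurableType d} {dX} {X : measurableType dX}
    {I : countType} (D : set T) (E : I -> set T) (e : I -> T -> X) :
  (forall w, D w -> {in [set i | E i w] &, injective (e^~ w)}) ->
  measurable D ->
  (forall i, measurable (D `&` E i)) ->
  (forall i, measurable_fun D (e i)) ->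
  measurable_fun D (fun w => [set e i w | i in [set i | E i w]] : config X).
Proof.
move=> einj mD mE me.
apply: (measurability (@count_events _ X : set (set (config X)))) => //.
move=> _ [_ [B [mB [n ->]]] <-].
rewrite (_ : _ `&` _ = D `&` [set w | ([set i | (E i `&` e i @^-1` B) w] #= `I_n)%card]).
  apply: measurable_card => // i.
  by rewrite setIA -[D]setIid -!setIA [D `&` (E i `&` _)]setICA setIA;
    apply: measurableI => //; exact: me.
apply/seteqP; split=> w /= -[Dw]; have inj := einj w Dw.
all: suff -> : [set e i w | i in [set i | E i w]] `&` B =
   (e^~ w) @` [set i | (E i `&` e i @^-1` B) w].
1,3: rewrite (card_eql (inj_card_eq _)) //.
1,2: by move=> i j /set_mem [? _] /set_mem [? _]; apply: inj; exact/mem_set.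
all: apply/seteqP; split=> x /=; first by move=> [[i Ei <-] Bx]; exists i.
all: by move=> [i [Ei Bi] <-]; split => //; exists i.
Qed.

(** Agrees with [zero_set] on walks started at 0, but depends on increments only and so is
    measurable on [paths]. *)
Definition zeros_of {R : realType} (s : paths) : config R :=
  [set n%:~R | n in [set n : int | s n - s 0 = 0]].

Lemma measurable_zeros_of {R : realType} : measurable_fun setT (@zeros_of R).
Proof.
refine (@measurable_to_config _ paths _ R int setT
  (fun n => [set s | s n - s 0 = 0]) (fun n _ => n%:~R) _ _ _ _) => //.
- by move=> w _ i j _ _ /intr_inj.
- by move=> i; rewrite setTI; exact: measurable_displacement.
Qed.

Lemma zero_set_walk {R : realType} {d} {T : measurableType d} {P : probability T R} {S}
  (hS : double_sided_simple_walk P S) w : zero_set R S w = zeros_of (walk_path S w).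
Proof.
apply/seteqP; split=> x [n /= h <-]; exists n => //=;
  by move: h; rewrite /walk_path (walk_start hS) subr0.
Qed.

Lemma zeros_of_shift {R : realType} (m : int) s : s m - s 0 = 0 ->
  zeros_of (shift_path m s) = translate (- m%:~R) (zeros_of s) :> set R.
Proof.
move=> sm; apply/seteqP; split=> x /=.
  move=> [n /= h <-]; exists (n + m)%:~R; last by rewrite intrD addrK.
  by exists (n + m) => //=; move: h; rewrite /shift_path add0r; lia.
move=> [y [n /= h <-] <-]; exists (n - m); last by rewrite intrB.
by rewrite /= /shift_path subrK add0r; lia.
Qed.

Lemma measurable_meets {d} {X : measurableType d} (B : set X) : measurable B ->
  measurable [set phi : config X | exists2 x, phi x & B x].
Proof.
move=> mB; rewrite (_ : mkset _ =
    ~` [set phi : config X | ((phi : set X) `&` B #= `I_0)%card]).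
  by apply: measurableC; apply: sub_sigma_algebra; exists B; split=> //; exists 0%N.
apply/seteqP; split=> phi /=; rewrite II0 card_eq0.
  by move=> [x phix Bx] /eqP; rewrite -subset0 => /(_ x); apply.
by move=> /negP/set0P[x [phix Bx]]; exists x.
Qed.

(** * The mark of the origin *)

Section origin.
Context {R : realType} {d : measure_display} {T : measurableType d}.
Context {P : probability T R} {Psi : T -> set R}.
Context {dX : measure_display} {Xi : measurableType dX}.
Variable Z : equivariant_process P Psi Xi.

(** Expresses a condition on the mark of the origin as an event of marked configurations, the only
    events to which the measurability and equivariance axioms apply. *)
Definition origin_event (C : set Xi) : set (config (R * R * Xi)%type) :=
  [set psi | exists2 xi, psi (0, 0, xi) & C xi].

Lemma measurable_origin_event C : measurable C -> measurable (origin_event C).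
Proof.
move=> mC.
have mB : measurable ([set 0] `*` [set 0] `*` C : set (R * R * Xi)).
  by apply: measurableX => //; exact: measurableX.
rewrite (_ : origin_event C = [set psi : config (R * R * Xi)%type |
    exists2 p, psi p & ([set 0] `*` [set 0] `*` C) p]); first exact: measurable_meets.
apply/seteqP; split=> psi /=.
  by move=> [xi psixi Cxi]; exists (0, 0, xi).
move=> [[[x y] xi] h [[/= x0 y0] /= Cxi]].
by exists xi => //; move: h; rewrite x0 y0.
Qed.

Lemma origin_event_marked C (phi : set R) z :
  origin_event C (marked phi z) <-> phi 0 /\ C (z 0 0).
Proof.
split=> [[xi [/= phi0 _ ->]] //|[phi0 Cz]].
by exists (z 0 0).
Qed.

Lemma measurable_origin_mark C : measurable C ->
  measurable_fun (ep_dom Z) (fun phi : config R =>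
    ep_prob Z [set u | phi 0 /\ C (ep_mark Z phi 0 0 u)]).
Proof.
move=> mC; have := ep_mark_measurable (measurable_origin_event C mC) (e := Z).
apply: eq_measurable_fun => phi _; congr (ep_prob Z _).
by apply/seteqP; split=> u /=; [move=> /origin_event_marked|move=> h; exact/origin_event_marked].
Qed.

(** Equivariance under the translation by [-v], which carries [v] to the origin. *)
Lemma origin_mark_equivariant C (phi : set R) v : measurable C ->
  ep_dom Z phi -> phi v ->
  ep_prob Z [set u | C (ep_mark Z phi v v u)] =
  ep_prob Z [set u | C (ep_mark Z (translate (- v) phi) 0 0 u)].
Proof.
move=> mC dphi phiv.
have t0 : translate (- v) phi 0 by exists v => //; rewrite subrr.
have := ep_equivariant (- v) dphi (measurable_origin_event C mC).
rewrite (_ : [set u | _] = [set u | C (ep_mark Z phi v v u)]); last first.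
  apply/seteqP; split=> u /=.
    by move=> /origin_event_marked[_]; rewrite opprK add0r.
  by move=> Cu; apply/origin_event_marked; rewrite opprK add0r.
move=> ->; congr (ep_prob Z _); apply/seteqP; split=> u /=.
  by move=> /origin_event_marked[].
by move=> Cu; apply/origin_event_marked.
Qed.

Lemma measurable_mark_event C (phi : set R) x : measurable C ->
  ep_dom Z phi -> phi x -> measurable [set u | C (ep_mark Z phi x x u)].
Proof.
move=> mC dphi phix; have := ep_mark_random dphi phix phix (e := Z).
by move=> /(_ measurableT _ mC); rewrite setTI.
Qed.

End origin.

(** * Relabelling marks, and coverings from r-coverings *)

Section map_process.
Context {R : realType} {d : measure_display} {T : measurableType d}.
Context {P : probability T R} {Psi : T -> set R}.
Context {dX : measure_display} {Xi : measurableType dX}.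
Context {dX' : measure_display} {Xi' : measurableType dX'}.
Variables (Z : equivariant_process P Psi Xi) (f : Xi -> Xi').
Hypotheses (mf : measurable_fun setT f) (injf : injective f).

Let g (p : R * R * Xi) : R * R * Xi' := (p.1, f p.2).

Let mapm (psi : config (R * R * Xi)%type) : config (R * R * Xi')%type :=
  g @` (psi : set (R * R * Xi)).

Let measurable_mapm : measurable_fun setT mapm.
Proof.
apply: (measurability (@count_events _ (R * R * Xi')%type :
  set (set (config (R * R * Xi')%type)))) => //.
move=> _ [_ [B [mB [n ->]]] <-]; rewrite setTI.
have mg : measurable_fun setT g.
  apply/measurable_fun_pairP; split; first exact: measurable_fst.
  exact: (measurableT_comp mf measurable_snd).
apply: sub_sigma_algebra; exists (g @^-1` B); split.
  by rewrite -[X in measurable X]setTI; exact: mg.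
exists n; apply/seteqP.
(* An injective relabelling preserves cardinalities, so a counting event pulls back to a counting
   event. *)
have injg : injective g by move=> [a b] [a' b'] [-> /injf ->].
have H psi : (mapm psi `&` B #= `I_n)%card =
    ((psi : set (R * R * Xi)) `&` g @^-1` B #= `I_n)%card.
  have -> : mapm psi `&` B = g @` ((psi : set (R * R * Xi)) `&` g @^-1` B).
    apply/seteqP; split=> p /=; first by move=> [[q psiq <-] Bq]; exists q.
    by move=> [q [psiq Bq] <-]; split=> //; exists q.
  by apply: card_eql; apply: inj_card_eq => p q _ _; exact: injg.
by split=> psi; rewrite /= H.
Qed.

Let mapm_marked (phi : set R) z :
  marked phi (fun x y => f (z x y)) = mapm (marked phi z).
Proof.
apply/seteqP; split=> [[[x y] xi] [/= phix phiy ->]|_ [[[x y] xi] [/= phix phiy ->] <-]].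
  by exists (x, y, z x y).
by [].
Qed.

Let mapm_event (A : set (config (R * R * Xi')%type)) : measurable A ->
  measurable (mapm @^-1` A).
Proof. by move=> mA; rewrite -[X in measurable X]setTI; exact: measurable_mapm. Qed.

Let map_mark (phi : set R) (x y : R) (u : ep_space Z) := f (ep_mark Z phi x y u).

Let map_mark_random (phi : set R) (x y : R) : ep_dom Z phi -> phi x -> phi y ->
  measurable_fun setT (map_mark phi x y).
Proof. by move=> dphi phix phiy; apply: measurableT_comp => //; exact: ep_mark_random. Qed.

Let map_mark_measurable (A : set (config (R * R * Xi')%type)) : measurable A ->
  measurable_fun (ep_dom Z) (fun phi : config R =>
    ep_prob Z [set u | A (marked phi (fun x y => map_mark phi x y u))]).
Proof.
move=> mA; have := ep_mark_measurable (e := Z) (mapm_event A mA).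
by apply: eq_measurable_fun => phi _ /=; congr (ep_prob Z _); apply/seteqP;
  split=> u /=; rewrite mapm_marked.
Qed.

Let map_equivariant (t : R) (phi : set R) : ep_dom Z phi ->
  forall A : set (config (R * R * Xi')%type), measurable A ->
    ep_prob Z [set u | A (marked (translate t phi)
                          (fun x y => map_mark phi (x - t) (y - t) u))] =
    ep_prob Z [set u | A (marked (translate t phi)
                          (fun x y => map_mark (translate t phi) x y u))].
Proof.
move=> dphi A mA; have := ep_equivariant t dphi (mapm_event A mA).
have H z : [set u : ep_space Z | (mapm @^-1` A) (marked (translate t phi) (z u))] =
  [set u | A (marked (translate t phi) (fun x y => f (z u x y)))].
  by apply/seteqP; split=> u /=; rewrite mapm_marked.
by rewrite !H.
Qed.

Definition map_process : equivariant_process P Psi Xi' :=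
  Build_equivariant_process (@ep_dom_measurable _ _ _ _ _ _ _ Z)
    (@ep_dom_locally_finite _ _ _ _ _ _ _ Z) (@ep_dom_translate _ _ _ _ _ _ _ Z)
    (@ep_dom_full _ _ _ _ _ _ _ Z) map_mark_random map_mark_measurable map_equivariant.

End map_process.

Section hausdorff_le.
Context {R : realType} {d : measure_display} {T : measurableType d}.
Context {P : probability T R} {Psi : T -> set R}.
Hypotheses (mPsi : measurable_fun setT (Psi : T -> config R)) (Psi0 : forall w, Psi w 0).

Lemma measurable_dom {dX} {Xi : measurableType dX} (Z : equivariant_process P Psi Xi) :
  measurable [set w | ep_dom Z (Psi w)].
Proof.
by rewrite -[X in measurable X]setTI; exact: mPsi measurableT _ (ep_dom_measurable Z).
Qed.

(** Selected points get radius [r] and the others radius 0. The inequality serves twice: it carries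
    upper bounds on intensities to [hausdorff1] and lower bounds on [hausdorff1] to [lambda]. *)
Lemma hausdorff1_le (alpha r : R) (Z : equivariant_process P Psi bool) :
  1 <= r -> is_r_covering r Z ->
  (hausdorff1 P Psi alpha <= (r `^ alpha)%:E * intensity Z)%E.
Proof.
move=> r1 covZ; have r0 : r != 0 by rewrite gt_eqF // (lt_le_trans _ r1).
pose f (b : bool) := if b then r else 0.
have mf : measurable_fun setT f by apply: measurable_fun_if => //.
have injf : injective f by move=> [] [] //= /esym/eqP; rewrite ?(negbTE r0) // eq_sym (negbTE r0).
apply: ge_ereal_inf; exists (mean_radius_pow alpha (map_process Z f mf injf)).
  exists (map_process Z f mf injf) => //; split.
    by move=> phi x y u _ _ _ /=; rewrite /f; case: ep_mark; [right|left].
  apply: filterS covZ => w; apply: filterS => u h x /h[v [phiv mv] bv].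
  by exists v => //=; rewrite mv.
have mdom := measurable_dom Z.
have mI : measurable_fun [set w | ep_dom Z (Psi w)]
    (fun w => ep_prob Z [set u : ep_space Z | ep_subset (Psi w) u 0]).
  apply: (measurable_comp (ep_dom_measurable Z) _
    (measurable_origin_mark Z [set true] _)) => //.
  - by move=> _ [w + <-].
  - exact: measurable_funS mPsi.
rewrite /mean_radius_pow /intensity -ge0_integralZl_EFin ?powR_ge0 //.
rewrite le_eqVlt; apply/orP; left; apply/eqP; apply: eq_integral => w /set_mem /= dw.
set A := [set u : ep_space Z | ep_subset (Psi w) u 0].
have mA : measurable A.
  rewrite (_ : A = [set u | [set true] (ep_mark Z (Psi w) 0 0 u)]).
    exact: measurable_mark_event.
  by apply/seteqP; split=> u /=; [case|move=> h; split].
transitivity (\int[ep_prob Z]_u ((r `^ alpha)%:E * (\1_A u)%:E))%E.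
  apply: eq_integral => u _; rewrite -EFinM indicE /f; congr (_%:E).
  have [|] := boolP (ep_mark Z (Psi w) 0 0 u) => h.
    by rewrite /pow0 (negbTE r0) mem_set ?mulr1 //; split.
  by rewrite /pow0 eqxx memNset ?mulr0 // => -[_]; apply/negP.
rewrite ge0_integralZl_EFin ?powR_ge0 //; first by rewrite integral_indic ?setIT.
by apply/measurable_EFinP; exact: measurable_indic.
Qed.
End hausdorff_le.

(** * Last points of random cells *)

Lemma measurable_fun_pair_in {d d1 d2} {T : measurableType d}
    {T1 : measurableType d1} {T2 : measurableType d2} (D : set T)
    (f : T -> T1) (g : T -> T2) :
  measurable_fun D f -> measurable_fun D g ->
  measurable_fun D (fun x => (f x, g x)).
Proof.
move=> mf mg mD; apply: (measurability _ (measurable_prod_measurableType T1 T2)) => //.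
move=> _ [_ [A mA [B mB <-]] <-].
rewrite (_ : _ `&` _ = (D `&` f @^-1` A) `&` (D `&` g @^-1` B)).
  by apply: measurableI; [exact: mf|exact: mg].
by apply/seteqP; split=> x /= ; tauto.
Qed.

Section lattice_configurations.
Context {R : realType}.

Definition frac_part (x : R) : R := x - (Num.floor x)%:~R.

Lemma frac_itv x : 0 <= frac_part x < 1.
Proof.
by rewrite /frac_part subr_ge0 floor_le /= ltrBlDl -[X in _ < _ + X]/(1%:~R) -intrD floorD1_gt.
Qed.

Lemma floorDint (x : R) (k : int) : Num.floor (x + k%:~R) = Num.floor x + k.
Proof. by rewrite floorDrz ?intrKfloor // intr_int. Qed.

Lemma fracDint (x : R) (k : int) : frac_part (x + k%:~R) = frac_part x.
Proof. by rewrite /frac_part floorDint intrD; lra. Qed.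

Lemma measurable_frac (B : set R) : measurable B -> measurable [set x | B (frac_part x)].
Proof.
move=> mB.
rewrite (_ : mkset _ = \bigcup_(k in [set: int])
    (`[k%:~R, (k + 1)%:~R[%classic `&` ((fun x : R => x - k%:~R) @^-1` B))).
  apply: measurable_bigcup_countType => k _; apply: measurableI => //.
  rewrite -[X in measurable X]setTI.
  have mf : measurable_fun setT (fun x : R => x - k%:~R) by exact: measurable_funB.
  exact: mf.
apply/seteqP; split=> x /=.
  move=> Bx; exists (Num.floor x) => //; split=> //=.
  by rewrite in_itv /=; exact: floor_itv.
move=> [k _ [/=]]; rewrite in_itv /= => xk.
by rewrite /frac_part (floor_def xk).
Qed.

(* The configurations contained in t + Z for some real t. *)
Definition lattice_like : set (config R) :=
  [set phi | forall x y : R, phi x -> phi y -> frac_part x = frac_part y].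

(** Two distinct fractional parts are separated by a rational, so countably many tests suffice: for
    each [q], the fractional parts are not on both sides of [q]. *)
Lemma measurable_lattice_like : measurable lattice_like.
Proof.
rewrite (_ : lattice_like = \bigcap_(q in [set: rat])
  (~` [set phi : config R | exists2 x, phi x & [set x | `]-oo, ratr q[%classic (frac_part x)] x] `|`
   ~` [set phi : config R | exists2 x, phi x & [set x | `[ratr q, +oo[%classic (frac_part x)] x])).
  apply: measurable_bigcap_countType => q _; apply: measurableU;
    by apply: measurableC; apply: measurable_meets; exact: measurable_frac.
apply/seteqP; split=> phi.
  move=> h q _; rewrite -setCI => -[[x phix] /= + [y phiy] /=].
  by rewrite !in_itv /= andbT (h x y phix phiy) ltNge => /negP.
move=> h x y; wlog : x y / frac_part x <= frac_part y => [H phix phiy|xy phix phiy].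
  by have [xy|/ltW yx] := leP (frac_part x) (frac_part y); [exact: H|apply/esym; exact: H].
apply/eqP; rewrite eq_le xy /= leNgt; apply/negP => /rat_in_itvoo[q].
rewrite in_itv /= => /andP[xq qy].
have := h q Logic.I; rewrite -setCI; apply; split.
  by exists x => //=; rewrite in_itv.
by exists y => //=; rewrite in_itv /= andbT ltW.
Qed.

(* 0 on the empty configuration. *)
Definition phase (phi : set R) : R := xget 0 (frac_part @` phi).

Lemma phaseE (phi : set R) x : lattice_like phi -> phi x -> phase phi = frac_part x.
Proof.
move=> lphi phix; rewrite /phase; case: xgetP => [_ -> [y phiy <-]|/(_ (frac_part x)) []].
  exact: lphi.
by exists x.
Qed.

Lemma phase0 : phase set0 = 0.
Proof. by rewrite /phase image_set0; case: xgetP. Qed.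

Lemma phase_itv (phi : set R) : 0 <= phase phi < 1.
Proof.
rewrite /phase; case: xgetP => [_ -> [y phiy <-]|_]; first exact: frac_itv.
by rewrite lexx ltr01.
Qed.

Lemma measurable_phase : measurable_fun lattice_like (phase : config R -> R).
Proof.
move=> mD B mB.
(* A nonempty configuration reveals its phase through any of its points; the empty one has the
   default phase 0 and is treated apart. *)
rewrite (_ : _ `&` _ = lattice_like `&`
  ([set phi : config R | exists2 x, phi x & B (frac_part x)] `|`
   ((~` [set phi : config R | exists2 x, phi x & setT x]) `&` [set phi | B 0]))).
  apply: measurableI => //; apply: measurableU.
    exact: (measurable_meets _ (measurable_frac _ mB)).
  apply: measurableI; first by apply: measurableC; exact: measurable_meets.
  have [B0|B0] := pselect (B 0).
    by rewrite (_ : mkset _ = setT) //; apply/seteqP; split.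
  by rewrite (_ : mkset _ = set0) //; apply/seteqP; split.
apply/seteqP; split=> phi [lphi].
  move=> /= Bp; split=> //.
  have [[x phix]|nphi] := pselect (exists x, phi x).
    by left; exists x => //; rewrite -(phaseE _ _ lphi phix).
  right; split; first by move=> [x phix _]; apply: nphi; exists x.
  rewrite /= -phase0; move: Bp; congr (B (phase _)).
  by apply/seteqP; split=> // x phix; apply: nphi; exists x.
move=> [[x phix Bx]|[nphi B0]]; split=> //=.
  by rewrite (phaseE _ _ lphi phix).
rewrite (_ : phi = set0) ?phase0 //.
by apply/seteqP; split=> // x phix; apply: nphi; exists x.
Qed.

(** On a lattice-like configuration the interval holds at most one point, [phase phi + k]. Stated
    with a fixed interval, the condition is a counting event. *)
Definition occupied (k : int) : set (config R) :=
  [set phi | exists2 x, phi x & `[k%:~R, (k + 1)%:~R[%classic x].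

Lemma measurable_occupied k : measurable (occupied k).
Proof. exact: measurable_meets. Qed.

Lemma occupiedE (phi : set R) k : lattice_like phi ->
  occupied k phi <-> phi (phase phi + k%:~R).
Proof.
move=> lphi; split=> [[x phix /=]|phik].
  rewrite in_itv /= => /floor_def xk.
  by rewrite (phaseE _ _ lphi phix) /frac_part xk subrK.
exists (phase phi + k%:~R) => //=; rewrite in_itv /= intrD.
by have := phase_itv phi; lra.
Qed.

Lemma lattice_likeE (phi : set R) x : lattice_like phi -> phi x ->
  x = phase phi + (Num.floor x)%:~R.
Proof. by move=> lphi phix; rewrite (phaseE _ _ lphi phix) /frac_part subrK. Qed.

End lattice_configurations.

(** * The process of last points of cells *)

Section uniform.
Context {R : realType}.
Variable n : nat.

Let weight_ge0 : 0 <= n.+1%:R^-1 :> R.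
Proof. by rewrite invr_ge0. Qed.

Definition uniform_below : set nat -> \bar R :=
  mscale (NngNum weight_ge0) (msum (fun i : nat => \d_i) n.+1).

HB.instance Definition _ := Measure.on uniform_below.

Lemma uniform_belowE (A : set nat) :
  uniform_below A = (n.+1%:R^-1 * (\sum_(i < n.+1) \1_A (val i)))%:E.
Proof. by rewrite /uniform_below /mscale /= /msum sumEFin -EFinM. Qed.

Let uniform_below_setT : uniform_below setT = 1%E.
Proof.
rewrite uniform_belowE (eq_bigr (fun=> 1)) => [|i _]; last by rewrite indicT.
by rewrite big_const_ord iter_addr_0 mulVf.
Qed.

HB.instance Definition _ := Measure_isProbability.Build _ _ R uniform_below
  uniform_below_setT.

End uniform.
Arguments uniform_below {R} n.

Section cell_process.
Context {R : realType} {d : measure_display} {T : measurableType d}.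
Context {P : probability T R} {Psi : T -> set R}.
Hypothesis Psi_lattice : forall w, lattice_like (Psi w).
Variable n : nat.

Definition cell_pos (k : int) (u : nat) : int := ((k - u%:Z) %% n.+1)%Z.

Lemma cell_pos_itv k u : 0 <= cell_pos k u < n.+1.
Proof. by rewrite /cell_pos modz_ge0 //= ltz_mod. Qed.

Lemma cell_posD k u (j : nat) : cell_pos k u + j%:Z < n.+1 ->
  cell_pos (k + j%:Z) u = cell_pos k u + j%:Z.
Proof.
move: (cell_pos_itv k u); rewrite /cell_pos.
rewrite (_ : k + j%:Z - u%:Z = (k - u%:Z) + j%:Z); last by lia.
rewrite -(modzDml (k - u%:Z)); move=> kitv h.
by apply: modz_small; move: kitv h; set c := (_ %% _)%Z; lia.
Qed.

(* u is the random offset: the line is cut at the points u + n.+1 Z, and the last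
   point of each cell is selected. *)
Definition last_in_cell (phi : set R) (x _ : R) (u : nat) : bool :=
  `[< forall j : nat, (0 < j)%N -> cell_pos (Num.floor x) u + j%:Z < n.+1 ->
        ~ phi (x + j%:R) >].

Let mark_random (phi : set R) (x y : R) : lattice_like phi -> phi x -> phi y ->
  measurable_fun setT (last_in_cell phi x y).
Proof. by []. Qed.

Lemma measurable_last_in_cell (k l : int) u : measurable_fun lattice_like
  (fun phi : config R => last_in_cell phi (phase phi + k%:~R) (phase phi + l%:~R) u).
Proof.
apply: (measurable_fun_bool true).
rewrite (_ : _ `&` _ = lattice_like `&`
  \bigcap_(j in [set j : nat | (0 < j)%N /\ cell_pos k u + j%:Z < n.+1])
    ~` occupied (k + j%:Z)).
  apply: measurableI; first exact: measurable_lattice_like.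
  by apply: measurable_bigcap_countType => j _; apply: measurableC; exact: measurable_occupied.
have fl (phi : set R) : Num.floor (phase phi + k%:~R) = k.
  rewrite floorDint (_ : Num.floor _ = 0) ?add0r //; apply: floor_def.
  exact: phase_itv.
apply/seteqP; split=> phi [lphi h]; split=> //.
  move=> j [j0 jn] /(occupiedE _ _ lphi); rewrite intrD addrA.
  by move/asboolP : h; apply; rewrite ?fl.
apply/asboolP => j j0; rewrite fl => jn phij.
by apply: (h j) => //; apply/(occupiedE _ _ lphi); rewrite intrD addrA.
Qed.

(** Enumerates the marked configuration by pairs of integers, the form required by
    [measurable_to_config]. *)
Lemma marked_lattice {dX} {Xi : measurableType dX} (phi : set R) (z : R -> R -> Xi) :
  lattice_like phi -> marked phi z =
  [set (phase phi + kl.1%:~R, phase phi + kl.2%:~R,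
        z (phase phi + kl.1%:~R) (phase phi + kl.2%:~R)) |
    kl in [set kl : int * int | occupied kl.1 phi /\ occupied kl.2 phi]].
Proof.
move=> lphi; apply/seteqP; split=> [[[x y] xi] [/= phix phiy ->]|].
  have ex := lattice_likeE _ _ lphi phix; have ey := lattice_likeE _ _ lphi phiy.
  exists (Num.floor x, Num.floor y) => /=; last by rewrite -ex -ey.
  by split; apply/(occupiedE _ _ lphi); rewrite -?ex -?ey.
by move=> _ [[k l] /= [/(occupiedE _ _ lphi) ok /(occupiedE _ _ lphi) ol] <-].
Qed.

(** The offset takes finitely many values, so the probability is a finite average of indicators. *)
Let mark_measurable (A : set (config (R * R * bool)%type)) : measurable A ->
  measurable_fun lattice_like (fun phi : config R =>
    uniform_below n [set u | A (marked phi (fun x y => last_in_cell phi x y u))] : \bar R).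
Proof.
move=> mA.
apply: (eq_measurable_fun (fun phi : config R => (n.+1%:R^-1 * \sum_(i < n.+1)
    \1_A (marked phi (fun x y => last_in_cell phi x y (val i))))%:E)) => [phi _|].
  by rewrite uniform_belowE.
apply/measurable_EFinP; apply: measurable_funM => //.
apply: measurable_sum => u.
apply: (measurable_comp measurableT (g := fun phi : config R =>
  marked phi (fun x y => last_in_cell phi x y (val u)))) => //.
suff hM : measurable_fun lattice_like (fun phi : config R =>
   [set (phase phi + kl.1%:~R, phase phi + kl.2%:~R,
        last_in_cell phi (phase phi + kl.1%:~R) (phase phi + kl.2%:~R) (val u)) |
    kl in [set kl : int * int | occupied kl.1 phi /\ occupied kl.2 phi]]
   : config (R * R * bool)%type).
  apply: eq_measurable_fun hM => phi /set_mem lphi.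
  by rewrite (marked_lattice _ _ lphi).
refine (@measurable_to_config _ (config R) _ (R * R * bool)%type (int * int)%type
    lattice_like (fun kl => occupied kl.1 `&` occupied kl.2)
    (fun kl phi => (phase phi + kl.1%:~R, phase phi + kl.2%:~R,
        last_in_cell phi (phase phi + kl.1%:~R) (phase phi + kl.2%:~R) (val u))) _ _ _ _).
- by move=> phi _ [k l] [k' l'] _ _ /= [/addrI/intr_inj -> /addrI/intr_inj -> _].
- exact: measurable_lattice_like.
- move=> kl; apply: measurableI; first exact: measurable_lattice_like.
  by apply: measurableI; exact: measurable_occupied.
- move=> kl; apply: measurable_fun_pair_in; last exact: measurable_last_in_cell.
  by apply: measurable_fun_pair_in; apply: measurable_funD => //; exact: measurable_phase.
Qed.

(** All points have the same fractional part, so a translation changes all their floors by one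
    integer [c]. Adding [c] to the offset modulo [n+1] restores the marks and permutes the offsets,
    hence keeps the uniform law. *)
Let mark_equivariant (t : R) (phi : set R) : lattice_like phi ->
  forall A : set (config (R * R * bool)%type), measurable A ->
    uniform_below n [set u | A (marked (translate t phi)
                          (fun x y => last_in_cell phi (x - t) (y - t) u))] =
    uniform_below n [set u | A (marked (translate t phi)
                          (fun x y => last_in_cell (translate t phi) x y u))] :> \bar R.
Proof.
move=> lphi A mA; rewrite !uniform_belowE; congr (_ * _)%:E.
have [c hc] : exists c : int, forall x, phi x -> Num.floor (x + t) = Num.floor x + c.
  have [[x0 px0]|nphi] := pselect (exists x, phi x); last first.
    by exists 0 => x phix; exfalso; apply: nphi; exists x.
  exists (Num.floor (x0 + t) - Num.floor x0) => x phix.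
  have -> : x + t = x0 + t + (Num.floor x - Num.floor x0)%:~R.
    by have := lphi _ _ phix px0; rewrite /frac_part intrB; lra.
  by rewrite floorDint; lia.
pose sh (u : 'I_n.+1) : 'I_n.+1 := inord `|((u%:Z + c) %% n.+1)%Z|%N.
have shE u : (sh u)%:Z = ((u%:Z + c) %% n.+1)%Z.
  have h : 0 <= ((u%:Z + c) %% n.+1)%Z < n.+1 by rewrite modz_ge0 //= ltz_mod.
  rewrite /sh inordK; move: h; set m := (_ %% _)%Z; lia.
have sh_inj : injective sh.
  move=> u v uv; apply/val_inj => /=.
  have /eqP := congr1 (fun i : 'I_n.+1 => i%:Z) uv; rewrite !shE eqz_modDr.
  by rewrite !modz_nat !modn_small //; lia.
rewrite [RHS](reindex_inj sh_inj) /=; apply: eq_bigr => u _.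
change (\1_A (marked (translate t phi)
    (fun x y => last_in_cell phi (x - t) (y - t) u)) =
  \1_A (marked (translate t phi)
    (fun x y => last_in_cell (translate t phi) x y (sh u))) :> R).
congr (\1_A _); apply/seteqP.
have H x y : translate t phi x -> last_in_cell phi (x - t) (y - t) u =
    last_in_cell (translate t phi) x y (sh u).
  move=> [x' phix' <-]; rewrite /last_in_cell addrK hc //.
  have pos : cell_pos (Num.floor x' + c) (sh u) = cell_pos (Num.floor x') u.
    rewrite /cell_pos shE -modzDmr modzNm modzDmr.
    by congr (_ %% _)%Z; lia.
  rewrite pos; apply: asbool_equiv_eq; split=> h j j0 jn.
    by move=> [y' phiy' e]; apply: (h j j0 jn); rewrite (_ : _ + _ = y') //; lra.
  by move=> phij; apply: (h j j0 jn); exists (x' + j%:R) => //; lra.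
by split=> -[[x y] b] [/= tx ty bE]; split=> //=; rewrite bE H.
Qed.

Let lattice_locally_finite (phi : set R) : lattice_like phi -> locally_finite phi.
Proof.
move=> lphi K /compact_bounded [M [_ /(_ (M + 1)) HM]].
have {}HM : K `<=` [set x | `|x| <= M + 1].
  by move=> x Kx; apply: HM => //; rewrite ltrDl.
pose m := Num.bound `|M + 1|.
have Mm : M + 1 < m%:R := le_lt_trans (ler_norm _) (archi_boundP (normr_ge0 _)).
apply: (@sub_finite_set _ _ ((fun i : nat => phase phi + (i%:Z - m%:Z)%:~R) @` `I_(m + m))).
  move=> x [phix /HM /= xM]; move: (floor_itv x) xM; rewrite ler_norml intrD => fx xM.
  have f1 : Num.floor x < m%:Z by rewrite -(ltr_int R); move: fx xM Mm; lra.
  have f2 : - m%:Z - 1 < Num.floor x.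
    by rewrite -(ltr_int R) intrB mulrNz; move: fx xM Mm; lra.
  exists (absz (Num.floor x + m%:Z)); first by rewrite /=; lia.
  by rewrite [RHS](lattice_likeE _ _ lphi phix); congr (_ + _%:~R); lia.
exact: finite_image.
Qed.

Let lattice_translate (t : R) (phi : set R) : lattice_like phi ->
  lattice_like (translate t phi).
Proof.
move=> lphi _ _ [x phix <-] [y phiy <-].
have -> : x + t = y + t + (Num.floor x - Num.floor y)%:~R.
  by have := lphi _ _ phix phiy; rewrite /frac_part intrB; lra.
by rewrite fracDint.
Qed.

Let lattice_full : P [set w | lattice_like (Psi w)] = 1%E.
Proof.
rewrite (_ : [set w | _] = setT) ?probability_setT //.
by apply/seteqP; split=> // w _; exact: Psi_lattice.
Qed.

Definition cell_process : equivariant_process P Psi bool :=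
  Build_equivariant_process (ep_prob := uniform_below n) measurable_lattice_like
    lattice_locally_finite lattice_translate lattice_full mark_random mark_measurable
    mark_equivariant.

End cell_process.

(** A point is at distance at most [n] from the last point of its own cell, found as the largest
    admissible displacement [j]. *)
Lemma cell_process_covering {R : realType} {d} {T : measurableType d}
    (P : probability T R) (Psi : T -> set R)
    (Psi_lattice : forall w, lattice_like (Psi w)) n r :
  n.+1%:R <= r -> is_r_covering r (cell_process Psi_lattice n (P := P)).
Proof.
move=> nr; have r0 : 0 < r by apply: lt_le_trans nr; rewrite ltr0n.
apply: nearW => w; apply: nearW => u x Psix.
pose later (j : nat) := `[< cell_pos n (Num.floor x) u + j%:Z < n.+1 /\ Psi w (x + j%:R) >].
have later0 : exists j, later j.
  exists 0%N; apply/asboolP; rewrite !addr0; split=> //.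
  by have /andP[] := cell_pos_itv n (Num.floor x) u.
have later_le j : later j -> (j <= n)%N.
  by move=> /asboolP[+ _]; have := cell_pos_itv n (Num.floor x) u; lia.
case: (ex_maxnP later0 later_le) => j /asboolP[jn Psij] jmax.
exists (x + j%:R); last first.
  rewrite /nball gt_eqF //; split=> //=.
  rewrite opprD addNKr normrN normr_nat (le_trans _ nr) // ler_nat.
  by have := cell_pos_itv n (Num.floor x) u; lia.
split=> //=; apply/asboolP => i i0.
have -> : j%:R = (j%:Z)%:~R :> R by [].
rewrite floorDint cell_posD // => ijn Psii.
suff : (j + i <= j)%N by lia.
apply: jmax.
apply/asboolP; rewrite natrD addrA; split=> //.
by rewrite PoszD addrA.
Qed.

(** * Intensity of the cell process on the zero set *)

Section walk.
Context {R : realType} {d : measure_display} {T : measurableType d}.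
Context {P : probability T R} {S : int -> T -> int}.
Hypothesis hS : double_sided_simple_walk P S.

Lemma zero_set_lattice w : lattice_like (zero_set R S w).
Proof.
move=> _ _ [n _ <-] [m _ <-].
by rewrite -[n%:~R]add0r -[m%:~R]add0r !fracDint.
Qed.

Lemma zero_setP w (n : int) : zero_set R S w n%:~R <-> S n w = 0.
Proof. by split=> [[m /= h /intr_inj <- //]|h]; exists n. Qed.

Definition cell_walk n := cell_process (P := P) zero_set_lattice n.

Definition no_return n : set T := [set w | forall k, (0 < k <= n)%N -> S k%:Z w != 0].

Lemma measurable_no_return n : measurable (no_return n).
Proof.
rewrite (_ : no_return n = \bigcap_(k in [set k | (0 < k <= n)%N]) ~` [set w | S k%:Z w = 0]).
  apply: measurable_bigcap_countType => k _; apply: measurableC.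
  exact: (walk_measurable hS).
by apply/seteqP; split=> w h k /h /eqP.
Qed.

Lemma origin_last_in_cell n u w :
  last_in_cell n (zero_set R S w) 0 0 u <-> no_return (n - absz (cell_pos n 0 u)) w.
Proof.
have c := cell_pos_itv n 0 u.
split=> [/asboolP h k /andP[k0 kn]|h].
  apply/negP => /eqP Sk; apply: (h k k0).
    by rewrite floor0; move: c kn; lia.
  by rewrite add0r; exact: (iffRL (zero_setP w k%:Z) Sk).
apply/asboolP => k k0; rewrite floor0 add0r => kn Sk.
suff : S k w != 0 by rewrite (iffLR (zero_setP w k%:Z) Sk) eqxx.
by apply: h; rewrite k0 /=; move: c kn; lia.
Qed.

(** The origin is selected when the walk does not return before the end of its cell. As the offset
    varies, the remaining length takes each value from 0 to [n] once, and averaging [3 / sqrt (s+1)]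
    over these gives the constant 6. *)
Lemma cell_walk_intensity n :
  (intensity (cell_walk n) <= (6 * (Num.sqrt n.+1%:R)^-1)%:E)%E.
Proof.
pose len (u : 'I_n.+1) := (n - absz (cell_pos n 0 u))%N.
have n1 : 0 <= n.+1%:R^-1 :> R by rewrite invr_ge0.
have -> : intensity (cell_walk n) =
    (\int[P]_w ((n.+1%:R^-1)%:E * \sum_(u < n.+1) (\1_(no_return (len u)) w)%:E))%E.
  rewrite /intensity (_ : [set w | _] = setT); last first.
    by apply/seteqP; split=> // w _; exact: zero_set_lattice.
  apply: eq_integral => w _ /=; rewrite uniform_belowE sumEFin -EFinM.
  congr (_ * _)%:E; apply: eq_bigr => u _; rewrite !indicE; congr (nat_of_bool _)%:R.
  apply/idP/idP => /set_mem h; apply/mem_set.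
    by case: h => _ /origin_last_in_cell.
  split; last exact/origin_last_in_cell.
  by rewrite -[0]/(0%:~R); apply/zero_setP; rewrite (walk_start hS).
have mI (u : 'I_n.+1) : measurable_fun setT (fun w => (\1_(no_return (len u)) w)%:E : \bar R).
  by apply/measurable_EFinP; apply: measurable_indic; exact: measurable_no_return.
rewrite ge0_integralZl_EFin //; last first.
- by apply: emeasurable_sum.
- by move=> w _; apply: sume_ge0 => u _; rewrite lee_fin.
rewrite ge0_integral_sum //.
rewrite (eq_bigr (fun u => P (no_return (len u)))) => [|u _]; last first.
  by rewrite integral_indic ?setIT //; exact: measurable_no_return.
apply: (@le_trans _ _ ((n.+1%:R^-1)%:E * \sum_(u < n.+1) (3 * (Num.sqrt (len u).+1%:R)^-1)%:E)%E).
  apply: lee_wpmul2l; first by rewrite lee_fin.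
  by apply: lee_sum => u _; rewrite (prob_no_return hS) lee_fin avoids0_le.
rewrite sumEFin -EFinM lee_fin -mulr_sumr.
have -> : \sum_(u < n.+1) (Num.sqrt (len u).+1%:R)^-1 =
          \sum_(i < n.+1) (Num.sqrt i.+1%:R)^-1 :> R.
  (* Offset 0 leaves [n] steps to the end of the cell, offset [i+1] leaves [i]. *)
  rewrite big_ord_recl big_ord_recr addrC /=; congr (_ + _).
    apply: eq_bigr => i _; congr ((Num.sqrt _%:R)^-1).
    rewrite /len /cell_pos /= sub0r.
    have h := ltn_ord i; rewrite -modzDl modz_small /bump leq0n; lia.
  by rewrite /len /cell_pos mod0z subn0.
have s0 : 0 < Num.sqrt n.+1%:R :> R by rewrite sqrtr_gt0 ltr0n.
rewrite ler_pdivrMl ?ltr0n //.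
have -> : n.+1%:R * (6 * (Num.sqrt n.+1%:R)^-1) = 3 * (2 * Num.sqrt n.+1%:R) :> R.
  rewrite -{1}(sqr_sqrtr (ler0n R n.+1)); field.
  by rewrite gt_eqF.
by rewrite ler_pM2l // sum_invsqrt_le.
Qed.

End walk.

(** * Tame zeros and mass transport *)

Lemma nneseries_le_bound {R : realType} (f : nat -> \bar R) (x : \bar R) :
  (forall i, 0 <= f i)%E -> (forall n, \sum_(i < n) f i <= x)%E ->
  (\sum_(i <oo) f i <= x)%E.
Proof.
move=> f0 fx; apply: lime_le; first by apply: is_cvg_nneseries.
by apply: nearW => n; rewrite big_mkord.
Qed.

(** The integral of a nonnegative function is a supremum over simple functions below it, hence
    monotone even for functions not known to be measurable, such as the mean radius as a function of
    the path. *)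
Lemma ge0_le_integral_nonmeasurable {d} {T : measurableType d} {R : realType}
    (mu : {measure set T -> \bar R}) (D : set T) (f g : T -> \bar R) :
  (forall x, 0 <= f x)%E -> (forall x, D x -> 0 <= g x)%E ->
  (forall x, D x -> f x <= g x)%E -> (forall x, ~ D x -> f x = 0%E) ->
  (\int[mu]_x f x <= \int[mu]_(x in D) g x)%E.
Proof.
move=> f0 g0 fg fD; rewrite ge0_integralTE // ge0_integralE //.
apply: le_ereal_sup => _ [h hf <-]; exists h => // x.
apply: le_trans (hf x) _; rewrite patchE; case: ifPn => [/set_mem|/negP] xD.
  exact: fg.
by rewrite fD // => /mem_set.
Qed.

Section tame.
Context {R : realType}.

Definition zeros_near (k : nat) (s : paths) : nat :=
  (\sum_(i < (2 ^ k).*2.+1) (s (i%:Z - (2 ^ k)%N%:Z)%R == s 0%R))%N.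

(** With [b = 2^alpha] the bound at scale [2^k] is [M (2^k)^alpha]. *)
Definition tame (M b : R) : set paths :=
  [set s | forall k, (zeros_near k s)%:R <= M * b ^+ k].

Lemma zeros_nearE k (s : paths) : (zeros_near k s)%:R =
  \sum_(i < (2 ^ k).*2.+1) \1_[set s : paths | s (i%:Z - (2 ^ k)%N%:Z) - s 0 = 0] s :> R.
Proof.
rewrite /zeros_near natr_sum; apply: eq_bigr => i _; rewrite indicE; congr (nat_of_bool _)%:R.
apply/idP/idP => [/eqP e|/set_mem /= /eqP]; last by rewrite subr_eq0.
by apply/mem_set => /=; rewrite e subrr.
Qed.

Lemma measurable_zeros_near k :
  measurable_fun setT (fun s : paths => (zeros_near k s)%:R : R).
Proof.
apply: (eq_measurable_fun (fun s : paths => \sum_(i < (2 ^ k).*2.+1)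
    \1_[set s : paths | s (i%:Z - (2 ^ k)%N%:Z) - s 0 = 0] s : R)) => [s _|].
  by rewrite zeros_nearE.
apply: measurable_sum => i; apply: measurable_indic; exact: measurable_displacement.
Qed.

Lemma measurable_crowded k (a : R) : measurable [set s : paths | a < (zeros_near k s)%:R].
Proof.
rewrite -[X in measurable X]setTI (_ : [set s | _] =
  (fun s : paths => (zeros_near k s)%:R : R) @^-1` `]a, +oo[).
  exact: measurable_zeros_near.
by apply/seteqP; split=> s; rewrite /= in_itv /= andbT.
Qed.

Lemma tameC M b : ~` tame M b = \bigcup_k [set s | M * b ^+ k < (zeros_near k s)%:R].
Proof.
apply/seteqP; split=> s.
  by move=> /existsNP[k /negP]; rewrite -ltNge => h; exists k.
by move=> [k _ /= h] /(_ k); rewrite leNgt h.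
Qed.

Lemma measurable_tame M b : measurable (tame M b).
Proof.
rewrite -[tame M b]setCK tameC; apply: measurableC.
by apply: bigcupT_measurable => k; exact: measurable_crowded.
Qed.

Context {d : measure_display} {T : measurableType d}.
Context {P : probability T R} {S : int -> T -> int}.
Hypothesis hS : double_sided_simple_walk P S.

(** Summing [(|n|+1)^(-1/2)] over [|n| <= m = 2^k] gives at most [4 sqrt (m+1)], which is at most
    [8 sqrt m]. *)
Lemma mean_zeros_near k :
  (\int[P]_w ((zeros_near k (walk_path S w))%:R)%:E <= (8 * Num.sqrt 2 ^+ k)%:E)%E.
Proof.
set m := (2 ^ k)%N.
pose f (j : nat) : R := (Num.sqrt j.+1%:R)^-1.
have mi (i : nat) : measurable [set s : paths | s (i%:Z - m%:Z) - s 0 = 0].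
  exact: measurable_displacement.
rewrite (_ : (fun w => _) = (fun w => \sum_(i < m.*2.+1)
   (\1_(walk_path S @^-1` [set s : paths | s (i%:Z - m%:Z) - s 0 = 0]) w)%:E)%E); last first.
  by apply/funext => w; rewrite sumEFin zeros_nearE.
rewrite ge0_integral_sum //; last first.
  move=> i; apply/measurable_EFinP; apply: measurable_indic.
  exact: (measurable_path_preimage hS).
apply: (@le_trans _ _ (\sum_(i < m.*2.+1) (f `|i%:Z - m%:Z|%N)%:E)%E).
  apply: lee_sum => i _.
  rewrite integral_indic ?setIT //; last exact: (measurable_path_preimage hS).
  rewrite (_ : _ @^-1` _ = [set w | S (i%:Z - m%:Z) w = 0]); first exact: prob_zero_le.
  by apply/seteqP; split=> w; rewrite /= /walk_path (walk_start hS) subr0.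
rewrite sumEFin lee_fin.
have f0 j : 0 <= f j by rewrite invr_ge0 sqrtr_ge0.
(* Negative times give the first sum, nonnegative times the second. *)
have -> : \sum_(i < m.*2.+1) f `|i%:Z - m%:Z|%N =
    \sum_(i < m) f i.+1 + \sum_(i < m.+1) f i.
  rewrite (_ : m.*2.+1 = m + m.+1)%N; last by lia.
  rewrite big_split_ord /= (reindex_inj rev_ord_inj); congr (_ + _).
    by apply: eq_bigr => i _; congr f; rewrite /=; have := ltn_ord i; lia.
  by apply: eq_bigr => i _; congr f; rewrite /=; lia.
have -> : \sum_(i < m) f i.+1 = \sum_(i < m.+1) f i - f 0%N.
  by rewrite big_ord_recl addrC addKr.
have := sum_invsqrt_le R m.+1; rewrite -/(f _) => h.
apply: (@le_trans _ _ (4 * Num.sqrt m.+1%:R)).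
  by have := f0 0%N; rewrite /f in h *; lra.
have sm : Num.sqrt 2 ^+ k = Num.sqrt m%:R :> R.
  by rewrite /m; elim: (k) => [|i IH]; rewrite ?expr0 ?sqrtr1 // exprS IH expnS natrM sqrtrM.
rewrite sm (_ : 8 = 4 * 2 :> R); last by lra.
rewrite -mulrA ler_pM2l //.
rewrite -(ler_pXn2r (ltn0Sn 1)) ?nnegrE ?mulr_ge0 ?sqrtr_ge0 //.
rewrite exprMn !sqr_sqrtr // -natrX -natrM ler_nat.
have : (0 < m)%N by rewrite expn_gt0.
by lia.
Qed.

(** Markov's inequality for [zeros_near]. *)
Lemma prob_crowded k (a : R) : 0 < a ->
  (P (walk_path S @^-1` [set s : paths | (a < (zeros_near k s)%:R)%R]) <=
   (a^-1 * (8 * Num.sqrt 2 ^+ k))%:E)%E.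
Proof.
move=> a0; set U := _ @^-1` _.
have mU : measurable U by exact: (measurable_path_preimage hS _ (measurable_crowded k a)).
rewrite EFinM -lee_pdivrMl ?invr_gt0 // invrK; apply: le_trans (mean_zeros_near k).
have -> : (a%:E * P U)%E = (\int[P]_w (a%:E * (\1_U w)%:E))%E.
  rewrite ge0_integralZl_EFin ?integral_indic ?setIT //; last exact: ltW.
  by apply/measurable_EFinP; exact: measurable_indic.
apply: ge0_le_integral => //.
- by move=> w _; rewrite -EFinM lee_fin mulr_ge0 // ltW.
- by apply/measurable_EFinP; apply: measurable_funM => //; exact: measurable_indic.
- apply/measurable_EFinP.
  apply: (measurableT_comp (measurable_zeros_near k)); exact: (measurable_path hS).
- move=> w _; rewrite -EFinM lee_fin indicE; case: (boolP (w \in U)) => [/set_mem /= Uw|_].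
    by rewrite mulr1 ltW.
  by rewrite mulr0.
Qed.

Lemma exists_tame (b : R) : Num.sqrt 2 < b ->
  exists2 M : R, 0 < M & ((2^-1)%:E <= P (walk_path S @^-1` (tame M b)))%E.
Proof.
move=> sb; have s0 : 0 < Num.sqrt 2 :> R by rewrite sqrtr_gt0.
have b0 : 0 < b by exact: lt_trans sb.
pose q := Num.sqrt 2 / b.
have q1 : 0 < 1 - q by rewrite subr_gt0 ltr_pdivrMr // mul1r.
have q0 : 0 <= q by rewrite divr_ge0 // ltW.
(* Scale [k] fails with probability at most [8 / M * q^k]; this [M] brings the geometric series to
   at most 1/2. *)
pose M := 16 / (1 - q); have M0 : 0 < M by rewrite divr_gt0.
exists M => //.
have mt := measurable_path_preimage hS _ (measurable_tame M b).
have tC : (P (~` (walk_path S @^-1` (tame M b))) <= (2^-1)%:E)%E.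
  rewrite preimage_setC tameC preimage_bigcup.
  pose U k := walk_path S @^-1` [set s : paths | M * b ^+ k < (zeros_near k s)%:R].
  have mU k : measurable (U k).
    exact: (measurable_path_preimage hS _ (measurable_crowded _ _)).
  apply: (@le_trans _ _ (\sum_(k <oo) P (U k))%E).
    by apply: measure_sigma_subadditive => //; exact: bigcupT_measurable.
  apply: nneseries_le_bound => // n.
  apply: (@le_trans _ _ (\sum_(k < n) (8 / M * q ^+ k)%:E)%E).
    apply: lee_sum => k _; apply: le_trans (prob_crowded k (M * b ^+ k) _) _.
      by rewrite mulr_gt0 ?exprn_gt0.
    rewrite lee_fin /q expr_div_n invfM le_eqVlt; apply/orP; left; apply/eqP.
    by ring.
  rewrite sumEFin lee_fin -mulr_sumr.
  have -> : \sum_(k < n) q ^+ k = (1 - q ^+ n) / (1 - q).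
    apply: (@mulIf _ (1 - q)); first by rewrite gt_eqF.
    rewrite divfK ?gt_eqF //; have := subrX1 q n.
    by move: (\sum_(_ < _) _) => s; lra.
  have qn : 0 <= q ^+ n by rewrite exprn_ge0.
  rewrite /M invf_div; have := q1; set c := 1 - q => c0.
  have -> : 8 * (c / 16) * ((1 - q ^+ n) / c) = (1 - q ^+ n) / 2.
    by field; rewrite gt_eqF.
  by lra.
move: tC; rewrite probability_setC // => tC.
rewrite -(fineK (fin_num_measure P _ mt)) in tC *.
by move: tC; rewrite -EFinB !lee_fin; lra.
Qed.

End tame.

(** * Mass transport between zeros *)

(** The order 0, -1, 1, -2, 2, ..., used to write sums over all integers as series over [nat]. *)
Definition int_enum (i : nat) : int := if odd i then - (i./2.+1)%:Z else (i./2)%:Z.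

Lemma int_enum_inj : injective int_enum.
Proof.
move=> i j; rewrite /int_enum.
have := odd_double_half i; have := odd_double_half j.
by case: (odd i); case: (odd j) => /=; lia.
Qed.

Lemma int_enum_surj (n : int) : exists i, int_enum i = n.
Proof.
have [n0|n0] := leP 0 n.
  by exists (absz n).*2; rewrite /int_enum odd_double doubleK; lia.
exists (absz n).-1.*2.+1; rewrite /int_enum /= odd_double /= uphalf_double; lia.
Qed.

Lemma shift_pathK n (s : int -> int) : shift_path (- n) (shift_path n s) = s.
Proof. by apply/funext => k; rewrite /shift_path subrK. Qed.

Lemma sum_bool_card (I : finType) (c : pred I) : (\sum_i c i = #|[pred i | c i]|)%N.
Proof. by rewrite -sum1_card [RHS]big_mkcond; apply: eq_bigr => i _; rewrite inE; case: (c i). Qed.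

(** All counted zeros lie within [2^m] of 0, hence within [2^(m+1)] of any one of them, say [f i0].
    Tameness of that one at scale [m+1] bounds their number. *)
Lemma tame_count {R : realType} (M b : R) (N m : nat) (f : nat -> int) (s : paths) (c : pred nat) :
  0 <= M -> 0 <= b -> injective f ->
  (forall i, c i -> tame M b (shift_path (f i) s) /\ s (f i) = s 0) ->
  (forall i, c i -> (absz (f i) <= 2 ^ m)%N) ->
  (\sum_(i < N) c i)%N%:R <= M * b ^+ m.+1.
Proof.
move=> M0 b0 finj cf fm.
have [[i0 ci0]|nc] := pselect (exists i, c i); last first.
  rewrite big1 ?mulr_ge0 ?exprn_ge0 // => i _.
  by apply/eqP; rewrite eqb0; apply/negP => ci; apply: nc; exists i.
have [/(_ m.+1) ti0 si0] := cf _ ci0.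
apply: le_trans ti0; rewrite ler_nat /zeros_near.
pose L := (2 ^ m.+1)%N; rewrite -/L.
(* The place of [f i] in the window of radius [L] around [f i0], which indexes the summands of
   [zeros_near]. *)
pose g i := absz (f i - f i0 + L%:Z).
have gP i : c i -> (g i < L.*2.+1)%N /\ (g i)%:Z = f i - f i0 + L%:Z.
  move=> ci; have := fm _ ci; have := fm _ ci0; rewrite /g /L expnS; lia.
rewrite !sum_bool_card.
pose h (i : 'I_N) : 'I_(L.*2.+1) := inord (g i).
have hinj : {in [pred i : 'I_N | c i] &, injective h}.
  move=> i j; rewrite !inE => ci cj /(congr1 val); rewrite /= !inordK ?(proj1 (gP _ _)) // => gij.
  have [_ gi] := gP _ ci; have [_ gj] := gP _ cj.
  by apply/val_inj/finj; move: gi gj; rewrite gij => -> /addIr/addIr.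
rewrite -(card_in_image hinj); apply: subset_leq_card.
apply/fintype.subsetP => x /mapP[i]; rewrite mem_enum => ci ->.
have ci' : c i by [].
have [gL gE] := gP _ ci'; rewrite inE /h inordK // gE /shift_path add0r.
have [_ si] := cf _ ci'.
by rewrite (_ : _ + _ = f i) ?si ?si0 //; lia.
Qed.

Section mass_transport.
Context {R : realType} {d : measure_display} {T : measurableType d}.
Context {P : probability T R} {S : int -> T -> int}.
Hypothesis hS : double_sided_simple_walk P S.

Lemma integral_shift (n : int) (f : paths -> \bar R) :
  measurable_fun setT f -> (forall s, 0 <= f s)%E ->
  (\int[P]_w f (shift_path n (walk_path S w)) = \int[P]_w f (walk_path S w))%E.
Proof.
move=> mf f0.
have m1 := measurable_path_shift hS n; have m2 := measurable_path hS.
have h1 := ge0_integral_pushforward m1 P measurableT mf (fun y _ => f0 y).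
have h2 := ge0_integral_pushforward m2 P measurableT mf (fun y _ => f0 y).
rewrite !preimage_setT /= in h1 h2.
rewrite -[LHS]h1 -[RHS]h2; apply: eq_measure_integral => A mA _.
exact: (shift_invariant hS n A mA).
Qed.

Lemma measurable_zero_set : measurable_fun setT (zero_set R S : T -> config R).
Proof.
rewrite (_ : (zero_set R S : T -> config R) = @zeros_of R \o walk_path S).
  exact: measurableT_comp measurable_zeros_of (measurable_path hS).
by apply/funext => w; exact: (zero_set_walk hS).
Qed.

Variable Z : equivariant_process P (zero_set R S) R.
Variables M b : R.

(** The condition [1 <= x] excludes the radius 0, whose ball is empty, also for [k = 0]. *)
Definition reaches (k : nat) : set R := [set x | 1 <= x /\ k%:R <= x].

Lemma measurable_reaches k : measurable (reaches k).
Proof.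
rewrite (_ : reaches k = `[1, +oo[%classic `&` `[k%:R, +oo[%classic).
  exact: measurableI.
by apply/seteqP; split=> x; rewrite /= !in_itv /= !andbT.
Qed.

(** Seen from the receiver at the origin, with a tame sender at [-n]. Inside [ep_dom] the mark
    probabilities are measurable in the configuration. *)
Definition sends_dom (n : int) : set paths :=
  [set s | [/\ tame M b (shift_path (- n) s), s (- n) - s 0 = 0 & ep_dom Z (zeros_of s : set R)]].

(* The expected mass, given the path s, that the origin receives from the point -n. *)
Definition sends (n : int) : paths -> \bar R :=
  (fun s => ep_prob Z [set u | (zeros_of s : set R) 0 /\
      reaches (absz n) (ep_mark Z (zeros_of s) 0 0 u)]) \_ (sends_dom n).

Lemma measurable_sends_dom n : measurable (sends_dom n).
Proof.
rewrite (_ : sends_dom n = (shift_path (- n) @^-1` tame M b) `&`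
  [set s | s (- n) - s 0 = 0] `&` (zeros_of @^-1` ep_dom Z)).
  apply: measurableI; first apply: measurableI.
  - by rewrite -[X in measurable X]setTI; apply: measurable_shift => //; exact: measurable_tame.
  - exact: measurable_displacement.
  - rewrite -[X in measurable X]setTI; apply: measurable_zeros_of => //.
    exact: ep_dom_measurable.
by apply/seteqP; split=> s [] // [].
Qed.

Lemma measurable_sends n : measurable_fun setT (sends n).
Proof.
have mo := measurable_origin_mark Z _ (measurable_reaches (absz n)).
have mz : measurable_fun (sends_dom n) (@zeros_of R : paths -> config R).
  by apply: measurable_funTS; exact: measurable_zeros_of.
have sub : (@zeros_of R : paths -> config R) @` sends_dom n `<=` ep_dom Z.
  by move=> _ [s [_ _ + ] <-].
have H := measurable_comp (ep_dom_measurable Z) sub mo mz.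
exact: (iffLR (measurable_restrictT _ (measurable_sends_dom n)) H).
Qed.

Lemma sends_ge0 n s : (0 <= sends n s)%E.
Proof. by rewrite /sends patchE; case: ifP. Qed.

Hypothesis covZ : is_covering Z.

Lemma zero_set0 w : zero_set R S w 0.
Proof. exact: (iffRL (zero_setP w 0) (walk_start hS w)). Qed.

(** Almost surely some ball contains the tame origin, so the events [V i] that the ball around
    [int_enum i] does so cover a set of full probability, and countable subadditivity gives total
    mass at least 1. Shifting the path to the centre makes it the receiver at the origin. *)
Lemma sends_cover w :
  ep_dom Z (zero_set R S w) -> tame M b (walk_path S w) ->
  {ae ep_prob Z, forall u, zero_set R S w `<=`
    \bigcup_(v in zero_set R S w) nball (zero_set R S w) (ep_mark Z (zero_set R S w) v v u) v} ->
  (1 <= \sum_(i <oo) sends (int_enum i) (shift_path (int_enum i) (walk_path S w)))%E.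
Proof.
move=> dw tw [N [mN N0 sub]].
set phi := zero_set R S w in dw sub *.
have phiE : phi = zeros_of (walk_path S w) by exact: (zero_set_walk hS).
pose V i := [set u | phi (int_enum i)%:~R /\
  reaches (absz (int_enum i)) (ep_mark Z phi (int_enum i)%:~R (int_enum i)%:~R u)].
have V0 i : ~ phi (int_enum i)%:~R -> V i = set0.
  by move=> h; apply/seteqP; split=> u // [].
have V1 i : phi (int_enum i)%:~R -> V i =
    [set u | reaches (absz (int_enum i)) (ep_mark Z phi (int_enum i)%:~R (int_enum i)%:~R u)].
  by move=> h; apply/seteqP; split=> u; [case|split].
have mV i : measurable (V i).
  have [h|h] := pselect (phi (int_enum i)%:~R); last by rewrite V0.
  by rewrite V1 //; exact: (measurable_mark_event _ _ _ _ (measurable_reaches _)).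
apply: (@le_trans _ _ (\sum_(i <oo) ep_prob Z (V i))%E).
  have <- : ep_prob Z (~` N) = 1%E by rewrite probability_setC // N0 sube0.
  apply: measure_sigma_subadditive => //; first exact: measurableC.
  move=> u Nu; have /(_ 0 (zero_set0 w)) : phi `<=`
      \bigcup_(v in phi) nball phi (ep_mark Z phi v v u) v.
    by apply: contrapT => h; apply: Nu; exact: sub.
  move=> [v phiv]; rewrite /nball; case: eqP => // m0 [_ /= vm].
  case: (phiv) => n _ nv; have [i ei] := int_enum_surj n.
  exists i => //; rewrite /V /= ei nv; split => //; split.
    by have [//|] := covZ.1 phi v v u dw phiv phiv.
  move: vm; rewrite sub0r normrN -nv -intr_norm.
  by rewrite -[X in X%:R]absz_nat -abszE.
apply: lee_nneseries => // i _.
have [h|h] := pselect (phi (int_enum i)%:~R); last by rewrite V0 // measure0 sends_ge0.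
rewrite V1 //; set n := int_enum i in h *.
have sn : walk_path S w n - walk_path S w 0 = 0.
  by move/zero_setP : h; rewrite /walk_path (walk_start hS) subr0.
have zE : zeros_of (shift_path n (walk_path S w)) = translate (- n%:~R) phi :> set R.
  by rewrite zeros_of_shift // phiE.
rewrite /sends patchE mem_set; last first.
  split; first by rewrite shift_pathK.
  - by rewrite /shift_path addNr add0r -opprB sn oppr0.
  - by rewrite zE; exact: ep_dom_translate.
(* Equivariance replaces the mark of [n] by the mark of the origin in the translated
   configuration. *)
rewrite zE (origin_mark_equivariant _ _ _ _ (measurable_reaches _) dw h).
rewrite le_eqVlt; apply/orP; left; apply/eqP; congr (ep_prob Z _).
apply/seteqP; split=> u /=; last by case.
by split => //; exists n%:~R => //; rewrite subrr.
Qed.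

Variable alpha : R.
Hypotheses (alpha0 : 0 <= alpha) (bE : b = 2 `^ alpha) (M0 : 0 < M).

Lemma pow2_powR m : (2 ^ m)%N%:R `^ alpha = b ^+ m.
Proof.
by rewrite bE natrX -powR_mulrn // -powRrM mulrC powRrM powR_mulrn // powR_ge0.
Qed.

(** If [2^m <= r < 2^(m+1)], the senders lie within [2^(m+1)] of the centre, and [tame_count] bounds
    their number by [M b^(m+2)], where [b^m = (2^m)^alpha <= r^alpha]. *)
Lemma sends_count N w u : ep_dom Z (zero_set R S w) ->
  (\sum_(i < N) `[< sends_dom (int_enum i) (walk_path S w) /\
     reaches (absz (int_enum i)) (ep_mark Z (zero_set R S w) 0 0 u) >])%N%:R <=
  (M * b ^+ 2) * pow0 (ep_mark Z (zero_set R S w) 0 0 u) alpha.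
Proof.
move=> dw; have z0 := zero_set0 w.
have b0 : 0 <= b by rewrite bE powR_ge0.
(* A centre of radius 0 receives nothing, in agreement with the convention [0^0 = 0]. *)
have [->|r1] := covZ.1 _ _ _ u dw z0 z0.
  rewrite /pow0 eqxx mulr0 big1 // => i _; apply/eqP; rewrite eqb0.
  by apply/asboolP => -[_ [+ _]]; rewrite ler10.
move: (ep_mark _ _ _ _ _) r1 => r r1.
have r0 : 0 < r by rewrite (lt_le_trans _ r1).
have t1 : (0 < Num.truncn r)%N by rewrite truncn_gt0.
pose m := trunc_log 2 (Num.truncn r).
have /andP[m1 m2] := trunc_log_bounds (isT : 1 < 2)%N t1.
have rm : r < (2 ^ m.+1)%N%:R.
  by apply: lt_le_trans (truncnS_gt _) _; rewrite ler_nat.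
have mr : (2 ^ m)%N%:R <= r.
  by apply: (@le_trans _ _ (Num.truncn r)%:R); rewrite ?ler_nat // truncn_le ltW.
apply: (@le_trans _ _ (M * b ^+ m.+2)).
  apply: (tame_count _ _ _ _ (fun i => - int_enum i)%R (walk_path S w)
    (fun i => `[< sends_dom (int_enum i) (walk_path S w) /\ reaches (absz (int_enum i)) r >])).
  - exact: ltW.
  - exact: b0.
  - by move=> i j /oppr_inj/int_enum_inj.
  - by move=> i /asboolP[[ti zi _] _]; split=> //; apply/eqP; rewrite -subr_eq0 zi.
  - move=> i /asboolP[_ [_ ir]]; rewrite abszN.
    by rewrite -(ler_nat R); apply: le_trans ir (ltW rm).
rewrite -mulrA ler_pM2l // -(addn2 m) exprD mulrC ler_wpM2l ?exprn_ge0 //.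
rewrite /pow0 gt_eqF // -pow2_powR.
by apply: ge0_ler_powR; rewrite // nnegrE ltW.
Qed.

Lemma measurable_pow0 : measurable_fun setT (fun x : R => pow0 x alpha).
Proof.
rewrite (_ : (fun x => _) = (fun x => x `^ alpha) \_ (~` [set 0])).
  apply: (iffLR (measurable_restrictT _ (measurableC (measurable_set1 0)))).
  by apply: measurable_funTS; exact: measurable_powR.
apply/funext => x; rewrite patchE /pow0; case: eqP => [->|x0].
  by rewrite memNset //= => /(_ erefl).
by rewrite mem_set.
Qed.

Let K := M * b ^+ 2.

Let K0 : 0 < K.
Proof. by rewrite /K mulr_gt0 // exprn_gt0 // bE powR_gt0. Qed.

(** The count in [sends_count] is integrated over the extra randomness, for each partial sum of the
    series. *)
Lemma sends_received w : ep_dom Z (zero_set R S w) ->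
  ((K^-1)%:E * \sum_(i <oo) sends (int_enum i) (walk_path S w) <=
   \int[ep_prob Z]_u (pow0 (ep_mark Z (zero_set R S w) 0 0 u) alpha)%:E)%E.
Proof.
move=> dw; rewrite lee_pdivrMl //; apply: nneseries_le_bound => [i|N].
  exact: sends_ge0.
have z0 := zero_set0 w; have phiE := zero_set_walk hS w.
pose V i := [set u | sends_dom (int_enum i) (walk_path S w) /\
     reaches (absz (int_enum i)) (ep_mark Z (zero_set R S w) 0 0 u)].
have mV i : measurable (V i).
  have [h|h] := pselect (sends_dom (int_enum i) (walk_path S w)).
    rewrite (_ : V i = [set u | reaches (absz (int_enum i)) (ep_mark Z (zero_set R S w) 0 0 u)]).
      exact: (measurable_mark_event _ _ _ _ (measurable_reaches _)).
    by apply/seteqP; split=> u; [case|split].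
  by rewrite (_ : V i = set0) //; apply/seteqP; split=> u // -[].
have sV i : sends (int_enum i) (walk_path S w) = (\int[ep_prob Z]_u (\1_(V i) u)%:E)%E.
  rewrite integral_indic // setIT /sends patchE -phiE.
  have [h|h] := pselect (sends_dom (int_enum i) (walk_path S w)).
    rewrite mem_set //; congr (ep_prob Z _).
    by apply/seteqP; split=> u /= [? ?].
  rewrite memNset // (_ : V i = set0) ?measure0 //.
  by apply/seteqP; split=> u // -[].
have mg : measurable_fun setT (fun u => (pow0 (ep_mark Z (zero_set R S w) 0 0 u) alpha)%:E).
  apply/measurable_EFinP; apply: (measurableT_comp measurable_pow0).
  exact: ep_mark_random.
have g0 x : 0 <= pow0 x alpha by rewrite /pow0; case: ifP => // _; exact: powR_ge0.
have mI i : measurable_fun setT (fun u => (\1_(V i) u)%:E : \bar R).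
  by apply/measurable_EFinP; exact: measurable_indic.
under eq_bigr do rewrite sV.
rewrite -ge0_integral_sum // -ge0_integralZl_EFin //; last first.
- exact: ltW.
- by move=> u _; rewrite lee_fin.
apply: ge0_le_integral => //.
- by move=> u _; rewrite sume_ge0 // => i _; rewrite lee_fin.
- exact: emeasurable_sum.
- exact: measurable_funeM.
move=> u _; rewrite sumEFin -EFinM lee_fin; apply: le_trans (sends_count N w u dw).
rewrite natr_sum le_eqVlt; apply/orP; left; apply/eqP.
by apply: eq_bigr => i _; rewrite indicE.
Qed.

Lemma mass_transport :
  ((K^-1)%:E * P (walk_path S @^-1` tame M b) <= mean_radius_pow alpha Z)%E.
Proof.
have mt := measurable_path_preimage hS _ (measurable_tame M b).
have ms i : measurable_fun setT (fun w => sends (int_enum i) (walk_path S w)).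
  exact: measurableT_comp (measurable_sends _) (measurable_path hS).
have ms' i : measurable_fun setT
    (fun w => sends (int_enum i) (shift_path (int_enum i) (walk_path S w))).
  exact: measurableT_comp (measurable_sends _) (measurable_path_shift hS _).
have mS : measurable_fun setT (fun w => \sum_(i <oo) sends (int_enum i) (walk_path S w))%E.
  by apply: ge0_emeasurable_sum => // k x _ _; exact: sends_ge0.
(* Shift invariance, term by term, replaces the mass the origin receives from [-n] by the mass it
   sends to [n]; summed over [n], the latter is at least 1 when the origin is tame. *)
have le1 : (P (walk_path S @^-1` tame M b) <=
    \int[P]_w \sum_(i <oo) sends (int_enum i) (walk_path S w))%E.
  rewrite integral_nneseries //; last by move=> i w _; exact: sends_ge0.
  have -> : (\sum_(i <oo) \int[P]_w sends (int_enum i) (walk_path S w) =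
    \sum_(i <oo) \int[P]_w sends (int_enum i) (shift_path (int_enum i) (walk_path S w)))%E.
    apply: eq_eseriesr => i _; rewrite integral_shift //.
      exact: measurable_sends.
    exact: sends_ge0.
  rewrite -integral_nneseries //; last by move=> i w _; exact: sends_ge0.
  rewrite -[X in P X]setIT -integral_indic //.
  apply: ae_ge0_le_integral => //.
  - by apply/measurable_EFinP; exact: measurable_indic.
  - by move=> w _; apply: nneseries_ge0 => i _ _; exact: sends_ge0.
  - by apply: ge0_emeasurable_sum => // k x _ _; exact: sends_ge0.
  have dom_ae : {ae P, forall w, ep_dom Z (zero_set R S w)}.
    exists (~` [set w | ep_dom Z (zero_set R S w)]); split => //.
      by apply: measurableC; exact: (measurable_dom measurable_zero_set).
    rewrite probability_setC ?(ep_dom_full Z) ?subee //.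
    exact: (measurable_dom measurable_zero_set).
  apply: filterS2 dom_ae covZ.2 => w dw cw _.
  have [tw|tw] := pselect (tame M b (walk_path S w)).
    by rewrite indicE mem_set //; exact: sends_cover.
  rewrite indicE memNset //; apply: nneseries_ge0 => i _ _; exact: sends_ge0.
apply: (@le_trans _ _ ((K^-1)%:E * \int[P]_w \sum_(i <oo) sends (int_enum i) (walk_path S w))%E).
  by rewrite lee_wpmul2l // lee_fin invr_ge0 ltW.
rewrite -ge0_integralZl_EFin //; last first.
- by rewrite invr_ge0 ltW.
- by move=> w _; apply: nneseries_ge0 => i _ _; exact: sends_ge0.
apply: ge0_le_integral_nonmeasurable.
- move=> w; apply: mule_ge0; first by rewrite lee_fin invr_ge0 ltW.
  by apply: nneseries_ge0 => i _ _; exact: sends_ge0.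
- move=> w _; apply: integral_ge0 => u _; rewrite lee_fin /pow0; case: ifP => // _.
  exact: powR_ge0.
- by move=> w dw; exact: sends_received.
(* Outside the domain [sends] vanishes by its definition as a restriction. *)
- move=> w dw; rewrite eseries0 ?mule0 // => i _ _.
  rewrite /sends patchE memNset // => -[_ _].
  by rewrite -(zero_set_walk hS).
Qed.

End mass_transport.

(** * Bounds on [hausdorff1] and [lambda] *)

Section bounds.
Context {R : realType} {d : measure_display} {T : measurableType d}.
Context {P : probability T R} {S : int -> T -> int}.
Hypothesis hS : double_sided_simple_walk P S.

Local Notation Psi := (zero_set R S).

Lemma hausdorff1_ge0 (alpha : R) : (0 <= hausdorff1 P Psi alpha)%E.
Proof.
apply: le_ereal_inf_tmp => _ [Z _ ->]; apply: integral_ge0 => w _.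
apply: integral_ge0 => u _; rewrite lee_fin /pow0; case: ifP => // _.
exact: powR_ge0.
Qed.

(** For [alpha > 1/2] the base [2^alpha] exceeds [sqrt 2], which makes tame origins likely; the
    constant from mass transport is the same for all coverings. *)
Lemma hausdorff1_gt0 (alpha : R) : 2^-1 < alpha ->
  exists2 c : R, 0 < c & (c%:E <= hausdorff1 P Psi alpha)%E.
Proof.
move=> alpha2; have alpha0 : 0 <= alpha by apply: ltW; lra.
have sb : Num.sqrt 2 < 2 `^ alpha :> R.
  rewrite -powR12_sqrt // lt_neqAle ler_powR ?ltW ?ltr1n // andbT.
  apply/eqP => /(congr1 (@ln R)); rewrite !ln_powR => /mulIf h.
  by move: alpha2; rewrite -h ?ltxx // gt_eqF // ln_gt0 // ltr1n.
have [M M0 Mtame] := exists_tame hS _ sb.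
pose K := M * (2 `^ alpha) ^+ 2.
have K0 : 0 < K by rewrite mulr_gt0 // exprn_gt0 // powR_gt0.
exists (K^-1 * 2^-1); first by rewrite mulr_gt0 // invr_gt0.
apply: le_ereal_inf_tmp => _ [Z covZ ->].
apply: le_trans (mass_transport hS Z M _ covZ alpha alpha0 erefl M0).
by rewrite EFinM lee_wpmul2l // lee_fin invr_ge0 ltW.
Qed.

Lemma hausdorff1_le_cell (alpha : R) n :
  (hausdorff1 P Psi alpha <= (n.+1%:R `^ alpha * (6 * (Num.sqrt n.+1%:R)^-1))%:E)%E.
Proof.
apply: le_trans (hausdorff1_le (measurable_zero_set hS) (zero_set0 hS) alpha n.+1%:R
  (cell_walk n) _ _) _.
- by rewrite ler1n.
- exact: cell_process_covering.
- rewrite EFinM lee_wpmul2l ?lee_fin ?powR_ge0 //; exact: cell_walk_intensity.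
Qed.

Lemma hausdorff1_eq0 (alpha : R) : alpha < 2^-1 -> hausdorff1 P Psi alpha = 0%E.
Proof.
move=> alpha2; apply/eqP; rewrite eq_le hausdorff1_ge0 andbT.
apply/lee_addgt0Pr => e e0; rewrite add0e.
pose del := 2^-1 - alpha; have del0 : 0 < del by rewrite subr_gt0.
(* The cell bound is [6 (n+1)^(-del)], and this choice forces [(n+1)^del >= 6 / e]. *)
pose n := Num.truncn ((6 / e) `^ del^-1).
apply: le_trans (hausdorff1_le_cell alpha n) _; rewrite lee_fin.
rewrite -powR12_sqrt // mulrCA -powRB ?pnatr_eq0 ?implybT //.
rewrite -[alpha - _]opprB powRN -/del.
have h : 6 / e <= n.+1%:R `^ del.
  have e6 : 6 / e = ((6 / e) `^ del^-1) `^ del.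
    by rewrite -powRrM mulVf ?lt0r_neq0 // powRr1 // divr_ge0 // ltW.
  rewrite [leLHS]e6.
  apply: ge0_ler_powR; rewrite ?nnegrE ?powR_ge0 ?ltW //.
  exact: truncnS_gt.
by rewrite ler_pdivrMr ?powR_gt0 // -ler_pdivrMl // mulrC.
Qed.

(** The cells have [n+1] points, the integer part of [r]; as [r <= 4 (n+1)], the constant 6 doubles
    to 12. *)
Lemma lambda_le (r : R) : 1 <= r -> (lambda P Psi r <= (12 * r `^ (- 2^-1))%:E)%E.
Proof.
move=> r1; have r0 : 0 < r by rewrite (lt_le_trans _ r1).
have t1 : (0 < Num.truncn r)%N by rewrite truncn_gt0.
pose n := (Num.truncn r).-1.
have nE : n.+1 = Num.truncn r by rewrite prednK.
have nr : n.+1%:R <= r by rewrite nE truncn_le ltW.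
have rn : r <= 4 * n.+1%:R.
  rewrite nE; apply: le_trans (ltW (truncnS_gt r)) _.
  rewrite -natrM ler_nat; move: t1; case: (Num.truncn r) => // k _; lia.
apply: le_trans (_ : intensity (cell_walk n) <= _)%E.
  by apply: ereal_inf_lbound; exists (cell_walk n) => //; exact: cell_process_covering.
apply: le_trans (cell_walk_intensity hS n) _; rewrite lee_fin powRN (powR12_sqrt (ltW r0)).
have s1 : 0 < Num.sqrt n.+1%:R :> R by rewrite sqrtr_gt0 ltr0n.
have s2 : 0 < Num.sqrt r by rewrite sqrtr_gt0.
rewrite ler_pdivrMr // mulrAC ler_pdivlMr //.
have : Num.sqrt r <= 2 * Num.sqrt n.+1%:R; last by lra.
rewrite -(ler_pXn2r (ltn0Sn 1)) ?nnegrE ?mulr_ge0 ?sqrtr_ge0 //.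
by rewrite exprMn (sqr_sqrtr (ltW r0)) sqr_sqrtr //; lra.
Qed.

(** An r-covering is a covering with constant radius on its selected points, so its intensity is at
    least [r^(-alpha)] times [hausdorff1]. *)
Lemma lambda_ge (alpha : R) : 2^-1 < alpha ->
  exists2 c : R, 0 < c & forall r, 1 <= r -> ((c * r `^ (- alpha))%:E <= lambda P Psi r)%E.
Proof.
move=> /hausdorff1_gt0[c c0 hc]; exists c => // r r1.
have r0 : 0 < r by rewrite (lt_le_trans _ r1).
apply: le_ereal_inf_tmp => _ [Z covZ ->].
have := le_trans hc (hausdorff1_le (measurable_zero_set hS) (zero_set0 hS) alpha r Z r1 covZ).
by rewrite powRN mulrC EFinM lee_pdivrMl ?powR_gt0.
Qed.

End bounds.

(** * From the bounds to the two dimensions *)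

Theorem proposition4p11 (R : realType) (d : measure_display)
  (T : measurableType d) (P : probability T R) (S : int -> T -> int)
  (hS : double_sided_simple_walk P S) :
  udimM_is P (zero_set R S) (2^-1)%:E /\ udimH P (zero_set R S) = (2^-1)%:E.
Proof.
split.
  have ev (e : R) : 0 < e -> \forall r \near +oo,
      exists2 g : R, ((- lne (lambda P (zero_set R S) r)) * ((ln r)^-1)%:E)%E = g%:E &
        `|2^-1 - g| <= e.
    (* Half of the error [e] goes to the exponent of the lower bound, the other half to its constant
       [c]. *)
    move=> e0; have [c c0 hc] := lambda_ge hS (2^-1 + e / 2) ltac:(lra).
    (* Once [ln r >= B], [|ln 12|] is at most [e ln r] and [|ln c|] at most [(e/2) ln r]; the
       summand 1 keeps [ln r] positive. *)
    pose B : R := 1 + (`|ln 12| / e + 2 * `|ln c| / e).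
    near=> r.
    have r1 : 1 <= r by near: r; apply: nbhs_pinfty_ge; rewrite num_real.
    have r0 : 0 < r by rewrite (lt_le_trans _ r1).
    have rB : expR B <= r by near: r; apply: nbhs_pinfty_ge; rewrite num_real.
    have LB : B <= ln r by rewrite -(expRK B) ler_ln ?posrE ?expR_gt0.
    have := lambda_le hS _ r1; have := hc _ r1.
    case: (lambda P _ r) => [l| |] //.
    rewrite !lee_fin => lc l12.
    have pc : 0 < c * r `^ (- (2^-1 + e / 2)) by rewrite mulr_gt0 ?powR_gt0.
    have l0 : 0 < l by exact: lt_le_trans lc.
    exists (- ln l / ln r); first by rewrite lne_EFin // -EFinN -EFinM.
    have h1 : ln l <= ln 12 - 2^-1 * ln r.
      rewrite -mulNr -ln_powR -lnM ?posrE ?powR_gt0 //.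
      by rewrite ler_ln ?posrE ?mulr_gt0 ?powR_gt0.
    have h2 : ln c - (2^-1 + e / 2) * ln r <= ln l.
      rewrite -mulNr -ln_powR -lnM ?posrE ?powR_gt0 //.
      by rewrite ler_ln ?posrE ?mulr_gt0 ?powR_gt0.
    move: h1 h2 LB; set L := ln r; rewrite /B => h1 h2 LB.
    have n1 : 0 <= `|ln 12| / e :> R by rewrite divr_ge0 // ltW.
    have n2 : 0 <= 2 * `|ln c| / e :> R by rewrite divr_ge0 ?mulr_ge0 // ltW.
    have L0 : 0 < L by lra.
    have k1 : `|ln 12| <= L * e :> R by rewrite -ler_pdivrMr //; lra.
    have k2 : 2 * `|ln c| <= L * e :> R by rewrite -ler_pdivrMr //; lra.
    have := ler_norm (ln 12 : R); have := ler_norm (- ln c); rewrite normrN => a1 a2.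
    have -> : 2^-1 - - ln l / L = (2^-1 * L + ln l) / L by field; rewrite gt_eqF.
    rewrite ler_norml ler_pdivlMr // ler_pdivrMr //; apply/andP; split; lra.
  rewrite /udimM_is; apply/fine_cvgP; split.
    by apply: filterS (ev 1 ltr01) => r [g -> _].
  apply/cvgrPdist_le => e e0; apply: filterS (ev e e0) => r [g h ge] /=.
  by rewrite h.
apply/eqP; rewrite eq_le; apply/andP; split.
  (* An exponent above 1/2 has positive [hausdorff1], so it cannot enter the supremum. *)
  apply: ge_ereal_sup => _ [->|[alpha [alpha0 /= h0] <-]]; first by rewrite lee_fin invr_ge0.
  rewrite lee_fin leNgt; apply/negP => /(hausdorff1_gt0 hS)[c c0].
  by rewrite h0 lee_fin leNgt c0.
apply/lee_addgt0Pr => e e0.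
(* For [e >= 1/2] the adjoined 0 is large enough; otherwise the exponent [1/2 - e] is nonnegative
   and belongs to the set. *)
have [e1|e1] := leP 2^-1 e.
  apply: (@le_trans _ _ (0 + e%:E)%E); first by rewrite add0e lee_fin.
  by apply: leeD2r; apply: ereal_sup_ubound; left.
rewrite -leeBlDr // -EFinB; apply: ereal_sup_ubound; right; exists (2^-1 - e) => //.
split; first by rewrite subr_ge0 ltW.
by apply: (hausdorff1_eq0 hS); lra.
Unshelve. all: by end_near.
Qed.
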